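(* Let $H=V\rtimes G$ be an algebraic group over an algebraically closed field $K$ of characteristic $p>0$, where $G$ is a connected algebraic group and $V$ is a unipotent group (written in additive notation). Assume that $V$ does not have closed $G$-invariant subgroups other than $0$ and $V$. Then $V$ is an abelian group of exponent $p$ and has a structure of a finite dimensional vector space over $K$ invariant under the action of $G$.
   Context: A unipotent group in characteristic $p>0$ is a linear algebraic group containing only $p$-elements. ''Closed'' means Zariski closed.
   Formalization: The vector space structure is claimed only when V is infinite or trivial: for finite nontrivial V (e.g. V = Z/p with G acting trivially) V cannot be a vector space over the infinite field K; ''abelian of exponent p'' is kept for all V. *)

(* Defs.v *)
From HB Require Import structures.
From mathcomp Require Import all_boot all_order all_algebra.
From mathcomp Require Import mpoly.
From mathcomp Require Import boolp classical_sets cardinality.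

Set Implicit Arguments.
Unset Strict Implicit.
Unset Printing Implicit Defensive.

Import GRing.Theory.
Local Open Scope classical_set_scope.
Local Open Scope ring_scope.

(* A linear algebraic group over K is a Zariski closed subgroup of GL_n(K); it is
   given by its set of points, K being algebraically closed.  For every n the
   ring structure on 'M[K]_n has 1 = 1%:M and product *m. *)

Definition mxeval (K : closedFieldType) (n : nat)
    (f : {mpoly K[n * n]}) (x : 'M[K]_n) : K :=
  f.@[fun i => mxvec x 0 i].

Definition GL_closed (K : closedFieldType) (n : nat) (A : set 'M[K]_n) : Prop :=
  exists S : set {mpoly K[n * n]},
    A = [set x | x \in unitmx /\ forall f, S f -> mxeval f x = 0].

Record closed_subgroup (K : closedFieldType) (n : nat) (A : set 'M[K]_n) : Prop :=
  ClosedSubgroup {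
    csg_closed : GL_closed A;
    csg_one : A 1;
    csg_mul : forall x y, A x -> A y -> A (x * y);
    csg_inv : forall x, A x -> A (invmx x)
  }.

(* When A is closed in GL_n(K), its relatively closed subsets are the closed
   subsets of GL_n(K) contained in A. *)
Definition GL_connected (K : closedFieldType) (n : nat) (A : set 'M[K]_n) : Prop :=
  forall B C : set 'M[K]_n, GL_closed B -> GL_closed C ->
    A = B `|` C -> B `&` C = set0 -> B = set0 \/ C = set0.

Definition unipotent (K : closedFieldType) (p n : nat) (V : set 'M[K]_n) : Prop :=
  closed_subgroup V /\ forall v, V v -> exists k : nat, v ^+ (p ^ k) = 1.

Definition conj_invariant (K : closedFieldType) (n : nat)
    (G A : set 'M[K]_n) : Prop :=
  forall g a, G g -> A a -> A (g * a * invmx g).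

Record semidirect (K : closedFieldType) (n : nat) (H V G : set 'M[K]_n) : Prop :=
  Semidirect {
    sd_subl : V `<=` H;
    sd_subr : G `<=` H;
    sd_normal : conj_invariant H V;
    sd_prod : forall h, H h -> exists v g, [/\ V v, G g & h = v * g];
    sd_disjoint : V `&` G = [set 1]
  }.

(* A finite dimensional K-vector space structure on the (multiplicatively written)
   group V, given by transport along the bijection phi from E onto V: the sum of
   phi x and phi y is phi x * phi y, and the multiple of phi x by c is
   phi (c *: x).  Scalar multiplication K x V -> V is required to be a morphism
   of varieties.  All elements of a unipotent V have determinant 1, so the regular
   functions on K x V are the polynomials in c and in the matrix entries. *)
Record vspace_structure (K : closedFieldType) (n : nat) (V : set 'M[K]_n)
    (E : vectType K) (phi : E -> 'M[K]_n) : Prop :=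
  VspaceStructure {
    vss_inj : injective phi;
    vss_image : range phi = V;
    vss_add : forall x y, phi (x + y) = phi x * phi y;
    vss_scale_regular : exists P : 'I_n -> 'I_n -> {mpoly K[1 + n * n]},
      forall (c : K) (x : E) (i j : 'I_n),
        phi (c *: x) i j =
        (P i j).@[fun k => row_mx (c%:M : 'M[K]_1) (mxvec (phi x)) 0 k]
  }.

Definition vspace_invariant (K : closedFieldType) (n : nat) (G : set 'M[K]_n)
    (E : vectType K) (phi : E -> 'M[K]_n) : Prop :=
  forall g, G g ->
    exists rho : 'End(E), forall x, g * phi x * invmx g = phi (rho x).

(* Main.v *)
Require Import Defs.
From HB Require Import structures.
From mathcomp Require Import all_boot all_order all_algebra.
From mathcomp Require Import mpoly.
From mathcomp Require Import boolp classical_sets functions cardinality.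
From mathcomp Require Import ring.

(* Write R for the ring of polynomial functions on V, A for its additive functions and F for
   the p-th power map, so that A is a module over the twisted polynomial ring K[F].
   The centre of V and then {v | v^p = 1} are nontrivial closed G-invariant subgroups, so V is
   abelian of exponent p. Let V be infinite.
   - A generates R. A function of degree m (all m+1-fold differences vanish) is reduced,
     modulo functions of smaller degree and products with additive functions, by the Taylor
     expansion (1 + delta_u)^(-e), which stops at the p-th term since delta_u^p = 0.
   - A is K[F]-torsion free: a torsion element has finitely many values, hence is invariant
     under the connected group G, and its kernel is 1 or V. So A has a finite K[F]-free family b
     generating R; it is algebraically independent, and identifies V with K^r because the
     points of the closed set V are the algebra homomorphisms from R to K.
   - Take a nonzero G-stable finite-dimensional subspace M of A of minimal dimension, not
     consisting of p-th powers of A. M is K[F]-free: a shortest relation makes M isomorphic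
     to a Frobenius twist, so that the traces of G on M lie in a finite field, hence are
     constant, and then Burnside's argument gives an invariant in M. The kernel of M is a
     G-invariant subgroup, hence trivial, so every element of A has some F^N-power in K[F]M,
     and then lies in K[F]M as M meets F(A) in 0. So M gives coordinates on V on which G acts
     linearly. *)

Set Implicit Arguments.
Unset Strict Implicit.
Unset Printing Implicit Defensive.
Import GRing.Theory.
Local Open Scope classical_set_scope.
Local Open Scope ring_scope.

(** * Matrix groups with constant trace and unipotent groups *)

(** The obstacle is that in characteristic p a closed subgroup of a vector group need not be a
    linear subspace, and a bijective homomorphism such as F need not have a regular inverse. An
    injective family of additive functions therefore does not yet give coordinates: on the line, the
    coordinate F would give the scalar multiplication by p-th roots, which [vss_scale_regular]
    excludes. Minimal dimension of M gives an irreducible action, freeness over K[F] gives algebraic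
    independence, and the absence of p-th powers makes the inverse of the coordinate map polynomial.

    Connectedness of [G] enters through one fact, that a regular function on [G] with finitely many
    values is constant. It is applied to the values of torsion elements of A along orbits and to the
    traces of [G] on M. *)

Lemma subspace_basis (K : fieldType) (d : nat) (P : 'rV[K]_d -> Prop) :
    P 0 -> (forall a u v, P u -> P v -> P (a *: u + v)) ->
  exists U : 'M[K]_d, forall w, P w <-> (w <= U)%MS.
Proof.
move=> P0 Plin.
pose good r := `[< exists U : 'M[K]_d, (forall w, (w <= U)%MS -> P w) /\ \rank U = r >].
have ex_good : exists r, good r.
  exists 0%N; apply/asboolP; exists 0; split; last exact: mxrank0.
  by move=> w; rewrite submx0 => /eqP ->.
have good_le r : good r -> (r <= d)%N.
  by move/asboolP=> [U [_ <-]]; exact: rank_leq_row.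
have [r /asboolP[U [UP rU]] rmax] := ex_maxnP ex_good good_le.
exists U => w; split; last exact: UP.
move=> Pw; apply: contraT => wU.
have /rmax : good (\rank (U + w)%MS).
  apply/asboolP; exists (U + w)%MS; split=> // z /sub_addsmxP [[a b] /= ->].
  have [c ->] : exists c, b *m w = c *: w.
    by exists (b 0 0); rewrite [b]mx11_scalar mul_scalar_mx mxE eqxx mulr1n.
  by rewrite addrC; apply: Plin => //; apply: UP; rewrite submxMl.
rewrite -rU leqNgt => /negP[].
rewrite ltn_neqAle mxrankS ?addsmxSl // andbT.
apply: contraNneq wU => rE.
by rewrite (submx_trans (addsmxSr U w)) // -(mxrank_leqif_sup (addsmxSl U w)) rE.
Qed.

(** * Burnside's argument for irreducible sets of matrices *)

Section Burnside.
Variables (K : closedFieldType) (d : nat).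

Definition irreducible_mxset (G : set 'M[K]_d) :=
  forall U : 'M_d, (forall g, G g -> (U *m g <= U)%MS) -> U = 0 \/ row_full U.

Inductive mxspan (G : set 'M[K]_d) : 'M[K]_d -> Prop :=
| Mxspan0 : mxspan G 0
| MxspanS c g a : G g -> mxspan G a -> mxspan G (c *: g + a).

Variable G : set 'M[K]_d.

Lemma mxspan_gen g : G g -> mxspan G g.
Proof. by move=> Gg; rewrite -[g]addr0 -[g]scale1r; apply: MxspanS => //; exact: Mxspan0. Qed.

Lemma mxspan_lin c a b : mxspan G a -> mxspan G b -> mxspan G (c *: a + b).
Proof.
move=> sa sb; elim: sa => [|e g a' Gg _ IH]; first by rewrite scaler0 add0r.
by rewrite scalerDr scalerA -addrA; apply: MxspanS.
Qed.

Hypothesis GM : forall g h, G g -> G h -> G (g *m h).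

Lemma mxspan_mul a b : mxspan G a -> mxspan G b -> mxspan G (a *m b).
Proof.
move=> sa sb; elim: sa => [|c g a' Gg _ IH]; first by rewrite mul0mx; exact: Mxspan0.
rewrite mulmxDl -scalemxAl; apply: mxspan_lin => //.
elim: sb => [|e h b' Gh _ IH']; first by rewrite mulmx0; exact: Mxspan0.
by rewrite mulmxDr -scalemxAr; apply: MxspanS => //; apply: GM.
Qed.

Hypotheses (G1 : G 1%:M) (Girr : irreducible_mxset G).

(** The vectors [w *m a] with [a] in the span form a nonzero stable subspace, so irreducibility
    makes it the whole space. *)
Lemma mxspan_transitive (w v : 'rV[K]_d) : w != 0 ->
  exists2 a, mxspan G a & v = w *m a.
Proof.
move=> w0.
have [||U UP] := @subspace_basis K d (fun v => exists2 a, mxspan G a & v = w *m a).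
- by exists 0; [exact: Mxspan0 | rewrite mulmx0].
- move=> c _ _ [a sa ->] [b sb ->]; exists (c *: a + b); first exact: mxspan_lin.
  by rewrite mulmxDr scalemxAr.
have [|U0|Ufull] := Girr (U := U).
- move=> g Gg; apply/row_subP=> i; apply/UP.
  have /UP[a sa rE] : (row i U <= U)%MS by exact: row_sub.
  by exists (a *m g); [apply: mxspan_mul => //; exact: mxspan_gen | rewrite row_mul rE mulmxA].
- case/eqP: w0; apply/eqP; rewrite -submx0 -U0; apply/UP.
  by exists 1%:M; [exact: mxspan_gen | rewrite mulmx1].
- by apply/UP; exact: submx_full.
Qed.

(* A nonzero element [a] of minimal rank in the span has rank one: otherwise, for an
   eigenvalue [l] of [b *m a] on the image of [a], the matrix [a *m b *m a - l *: a]
   has smaller rank. *)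
Lemma mxspan_rank1 : (0 < d)%N -> exists2 a, mxspan G a & \rank a = 1%N.
Proof.
move=> d0.
pose good r := `[< exists a, [/\ mxspan G a, a != 0 & \rank a = r] >].
have exg : exists r, good r.
  exists d; apply/asboolP; exists 1%:M; split; [exact: mxspan_gen | | exact: mxrank1].
  by rewrite -mxrank_eq0 mxrank1 -lt0n.
have [r /asboolP [a [sa a0 ra]] rmin] := ex_minnP exg.
exists a => //; apply/eqP; rewrite eqn_leq lt0n mxrank_eq0 a0 andbT.
rewrite leqNgt; apply/negP=> r2.
have [B Bfree Ba] : exists2 B : 'M_(\rank a, d), row_free B & (B :=: a)%MS.
  by exists (row_base a); [exact: row_base_free | exact: eq_row_base].
have r0 : (0 < \rank a)%N by apply: ltn_trans r2.
pose y : 'rV[K]_d := row (Ordinal r0) B.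
pose z : 'rV[K]_d := row (Ordinal r2) B.
have /submxP[x yE] : (y <= a)%MS by rewrite -Ba row_sub.
have /submxP[x' zE] : (z <= a)%MS by rewrite -Ba row_sub.
have y0 : y != 0.
  apply/eqP => h; have := row_freeP Bfree => -[D BD].
  have : row (Ordinal r0) (B *m D) = 0 by rewrite row_mul -/y h mul0mx.
  rewrite BD => /rowP/(_ (Ordinal r0)); rewrite !mxE eqxx; move/eqP; by rewrite oner_eq0.
have yz l : z != l *: y.
  apply/eqP => h; have := row_freeP Bfree => -[D BD].
  have : row (Ordinal r2) (B *m D) = l *: row (Ordinal r0) (B *m D).
    by rewrite !row_mul scalemxAl; congr (_ *m _).
  rewrite BD => /rowP/(_ (Ordinal r2)); rewrite !mxE eqxx /= mulr0 => /eqP.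
  by rewrite oner_eq0.
(* Now [x *m (a *m b *m a)] is [z], which is no multiple of [y = x *m a]. Hence [a'] below is
   nonzero whatever the eigenvalue [l]. *)
have [b sb x'E] := mxspan_transitive x' y0.
pose c := b *m a.
pose C := B *m c *m pinvmx B.
have CB : C *m B = B *m c.
  by rewrite mulmxKpV // Ba /c mulmxA submxMl.
have [l lC] : exists l, root (char_poly C) l.
  apply: closed_rootP; by rewrite size_char_poly eqSS -lt0n.
have /eigenvalueP [w wC w0] : eigenvalue C l by rewrite eigenvalue_root_char.
pose a' := a *m c - l *: a.
have sa' : mxspan G a'.
  rewrite /a' addrC -scaleNr; apply: mxspan_lin => //.
  by apply: mxspan_mul => //; apply: mxspan_mul.
have a'0 : a' != 0.
  apply/eqP => h; have : x *m a' = 0 by rewrite h mulmx0.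
  rewrite /a' mulmxBr mulmxA -scalemxAr -yE /c mulmxA -x'E -zE => /eqP.
  by rewrite subr_eq0 (negPf (yz l)).
have a'E : a' = a *m (c - l%:M) by rewrite /a' mulmxBr mul_mx_scalar.
have : good (\rank a') by apply/asboolP; exists a'.
move/rmin; rewrite -ra leqNgt => /negP[].
have := mxrank_mul_ker a (c - l%:M); rewrite -a'E => <-.
rewrite -[X in (X < _)%N]addn0 ltn_add2l lt0n mxrank_eq0.
apply/eqP => h.
have : (w *m B <= a :&: kermx (c - l%:M))%MS.
  rewrite sub_capmx -Ba submxMl /=; apply/sub_kermxP.
  by rewrite mulmxBr -mulmxA -CB mulmxA wC mul_mx_scalar scalemxAl subrr.
rewrite h submx0 => /eqP wB0; case/eqP: w0.
by apply: (row_free_inj Bfree); rewrite wB0 mul0mx.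
Qed.

(** Constant trace gives [\tr ((g - 1%:M) *m c) = 0] for all [c] in the span. A rank one element is
    some [u *m f]; if [f *m (g - 1%:M)] were nonzero, an element [b] of the span would carry it to a
    coordinate vector at which [u] is nonzero, and [c = b *m (u *m f)] would give a nonzero
    trace. *)
Lemma irreducible_mxtrace_fixed : (0 < d)%N -> (forall g, G g -> \tr g = d%:R) ->
  exists2 f : 'rV_d, f != 0 & forall g, G g -> f *m g = f.
Proof.
move=> d0 Gtr.
have [a sa ra] := mxspan_rank1 d0.
have [f f0 /submxP[u aE]] : exists2 f : 'rV[K]_d, f != 0 & (a <= f)%MS.
  have f0 : nz_row a != 0 by rewrite nz_row_eq0 -mxrank_eq0 ra.
  exists (nz_row a) => //.
  by rewrite -(geq_leqif (mxrank_leqif_sup (nz_row_sub a))) ra rank_rV f0.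
exists f => // g Gg; apply/eqP; rewrite -subr_eq0; apply: contraT => psi0.
have u0 : u != 0 by apply: contra_eq_neq ra => u0; rewrite aE u0 mul0mx mxrank0.
have [i ui] : exists i, u i 0 != 0.
  apply/existsP; apply: contraNT u0 => /existsPn h; apply/eqP/colP=> i.
  by rewrite mxE; apply/eqP; move: (h i); rewrite negbK.
have [b sb bE] := mxspan_transitive (delta_mx 0 i) psi0.
have tr0 c : mxspan G c -> \tr ((g - 1%:M) *m c) = 0.
  elim=> [|e h c' Gh _ IH]; first by rewrite mulmx0 mxtrace0.
  rewrite mulmxDr mxtraceD IH addr0 -scalemxAr mxtraceZ mulmxBl mul1mx.
  by rewrite mxtraceD raddfN /= !Gtr ?subrr ?mulr0 //; apply: GM.
have := tr0 _ (mxspan_mul sb sa).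
rewrite aE !mulmxA mxtrace_mulC !mulmxA mulmxBr mulmx1 -bE.
rewrite -rowE trace_mx11 !mxE => /eqP.
by rewrite (negPf ui).
Qed.
End Burnside.

(** In characteristic p, [l ^+ (p ^ k) = 1] forces [l = 1], so the trace is a sum of [d] eigenvalues
    all equal to 1. *)
Lemma mxtrace_expr_pchar (K : closedFieldType) (p : nat) (Kp : p \in [pchar K])
    (d k : nat) (c : 'M[K]_d) : c ^+ (p ^ k) = 1 -> \tr c = d%:R.
Proof.
move=> ck1; case: d c ck1 => [|d] c ck1; first by rewrite /mxtrace big_ord0.
have root1 l : root (char_poly c) l -> l = 1.
  rewrite -eigenvalue_root_char => /eigenvalueP[w wc w0].
  have wcn m : w *m c ^+ m = l ^+ m *: w.
    elim: m => [|m IH]; first by rewrite !expr0 mulmx1 scale1r.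
    by rewrite exprSr -mulmxE mulmxA IH -scalemxAl wc scalerA exprSr.
  have := wcn (p ^ k)%N; rewrite ck1 mulmx1 => /esym/eqP.
  rewrite -subr_eq0 -[X in _ - X]scale1r -scalerBl scaler_eq0 (negPf w0) orbF.
  have -> : l ^+ (p ^ k) - 1 = (l - 1) ^+ (p ^ k).
    have pn : [pchar K].-nat (p ^ k)%N.
      by rewrite pnatX pnatE ?Kp // (pcharf_prime Kp).
    by rewrite exprDn_pchar // exprNn_pchar // expr1n.
  by rewrite expf_eq0 => /andP[_]; rewrite subr_eq0 => /eqP.
have [rs rsE] := closed_field_poly_normal (char_poly c).
move: rsE; rewrite (monicP (char_poly_monic c)) scale1r => rsE.
have rs1 l : l \in rs -> l = 1 by move=> lrs; apply: root1; rewrite rsE root_prod_XsubC.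
have srs : size rs = d.+1.
  by apply: succn_inj; rewrite -(size_prod_XsubC rs id) -rsE size_char_poly.
have := char_poly_trace c isT; rewrite rsE -{1}srs.
rewrite coefPn_prod_XsubC ?srs // => /oppr_inj <-.
rewrite (eq_big_seq (fun=> 1)); last by move=> l /rs1.
by rewrite big_const_seq count_predT srs -Monoid.iteropE.
Qed.

(** * Kolchin's theorem for unipotent representations *)

Section UnipotentRep.
Variables (K : closedFieldType) (p : nat) (X : Type) (op : X -> X -> X) (e : X).
Hypothesis Kp : p \in [pchar K].

Definition unip_rep (d : nat) (rho : X -> 'M[K]_d) :=
  [/\ rho e = 1%:M, forall x y, rho (op x y) = rho x *m rho y
    & forall x, exists k, rho x ^+ (p ^ k) = 1].

(** On a nonzero stable subspace of least rank the action is irreducible and every trace equals the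
    dimension, so Burnside's argument applies there. *)
Lemma unip_rep_fixed d (rho : X -> 'M[K]_d) : unip_rep rho -> (0 < d)%N ->
  exists2 f : 'rV_d, f != 0 & forall x, f *m rho x = f.
Proof.
move=> [rho1 rhoM rhoU] d0.
pose good r := `[< exists U : 'M[K]_d, [/\ U != 0, forall x, (U *m rho x <= U)%MS & \rank U = r] >].
have exg : exists r, good r.
  exists d; apply/asboolP; exists 1%:M; split; [|by move=> x; rewrite submx1|exact: mxrank1].
  by rewrite -mxrank_eq0 mxrank1 -lt0n.
have [r /asboolP [U [U0 Ust rU]] rmin] := ex_minnP exg.
have [B Bfree BU] : exists2 B : 'M_(\rank U, d), row_free B & (B :=: U)%MS.
  by exists (row_base U); [exact: row_base_free | exact: eq_row_base].
pose C x := B *m rho x *m pinvmx B.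
have CB x : C x *m B = B *m rho x.
  by rewrite mulmxKpV // BU (eqmxMr _ BU).
have CM x y : C (op x y) = C x *m C y.
  by apply: (row_free_inj Bfree); rewrite -mulmxA !CB mulmxA CB rhoM mulmxA.
have C1 : C e = 1%:M.
  by apply: (row_free_inj Bfree); rewrite CB rho1 mulmx1 mul1mx.
have CX x m : C x ^+ m *m B = B *m rho x ^+ m.
  elim: m => [|m IH]; first by rewrite !expr0 mulmx1 mul1mx.
  by rewrite !exprSr -!mulmxE -mulmxA CB mulmxA IH mulmxA.
have CU x : exists k, C x ^+ (p ^ k) = 1.
  have [k rk] := rhoU x; exists k.
  by apply: (row_free_inj Bfree); rewrite CX rk mulmx1 mul1mx.
have [|||||f f0 fC] := @irreducible_mxtrace_fixed K (\rank U) (range C).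
- by move=> _ _ [x _ <-] [y _ <-]; exists (op x y).
- by exists e.
- move=> W Wst; have [W0|W0] := eqVneq W 0; [by left | right].
  have WB0 : (<<W *m B>>)%MS != 0.
    rewrite -mxrank_eq0 genmxE mxrank_eq0; apply: contra_neq W0 => h.
    by apply: (row_free_inj Bfree); rewrite h mul0mx.
  have : good (\rank (<<W *m B>>)%MS).
    apply/asboolP; exists (<<W *m B>>)%MS; split => // x.
    rewrite genmxE (eqmxMr _ (genmxE _)) -mulmxA -CB mulmxA.
    by apply: submxMr; apply: Wst; exists x.
  move/rmin; rewrite -rU genmxE => le.
  by rewrite -col_leq_rank (leq_trans le) // mxrankMfree.
- by rewrite lt0n mxrank_eq0.
- move=> _ [x _ <-]; have [k Ck] := CU x.
  exact: mxtrace_expr_pchar Ck.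
exists (f *m B).
  by apply: contra_neq f0 => h; apply: (row_free_inj Bfree); rewrite h mul0mx.
by move=> x; rewrite -mulmxA -CB mulmxA fC //; exists x.
Qed.

(** The ascending filtration whose j-th term consists of the row vectors fixed modulo the preceding
    term. *)
Fixpoint killed d (rho : X -> 'M[K]_d) (j : nat) (w : 'rV_d) : Prop :=
  if j is i.+1 then forall x, killed rho i (w *m (rho x - 1%:M)) else w = 0.

Lemma killed_lin d (rho : X -> 'M[K]_d) j a u v :
  killed rho j u -> killed rho j v -> killed rho j (a *: u + v).
Proof.
elim: j u v => [|j IH] u v /=; first by move=> -> ->; rewrite scaler0 addr0.
by move=> hu hv x; rewrite mulmxDl -scalemxAl; apply: IH.
Qed.

Lemma killedS d (rho : X -> 'M[K]_d) j w : killed rho j w -> killed rho j.+1 w.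
Proof.
elim: j w => [|j IH] w /=; first by move=> -> x; rewrite mul0mx.
by move=> h x; apply: IH.
Qed.

Lemma killed_mul d (rho : X -> 'M[K]_d) j w x :
  killed rho j w -> killed rho j (w *m rho x).
Proof.
move=> h; have -> : w *m rho x = 1 *: (w *m (rho x - 1%:M)) + w.
  by rewrite scale1r mulmxBr mulmx1 subrK.
by apply: killed_lin => //; apply: (killedS h).
Qed.

(** Simultaneous unitriangular form, by induction on [d] through the quotient by a fixed line. *)
Lemma unip_rep_killed d (rho : X -> 'M[K]_d) : unip_rep rho ->
  exists m, forall w, killed rho m w.
Proof.
have [k] := ubnP d; elim: k d rho => // k IH d rho dk rhoP.
have [d0|d0] := posnP d.
  by exists 0%N => w /=; move: w; rewrite d0 => w; rewrite thinmx0.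
have [f f0 fP] := unip_rep_fixed rhoP d0.
have rf : \rank f = 1%N by rewrite rank_rV f0.
(* Right multiplication by [D] is the projection onto the quotient by the line of [f]; [E] is a
   section of it, and [sigma] the action on the quotient. *)
set D := col_base (cokermx f).
have kerD w : w *m D = 0 -> (w <= f)%MS.
  by move=> wD; rewrite submxE -[cokermx f]mulmx_base mulmxA wD mul0mx.
have fD : f *m D = 0.
  apply: (row_free_inj (row_base_free (cokermx f))).
  by rewrite -mulmxA mulmx_base mulmx_coker mul0mx.
have [E ED] := row_fullP (col_base_full (cokermx f)).
rewrite -/D in ED; clearbody D.
have fixed w x : (w <= f)%MS -> w *m (rho x - 1%:M) = 0.
  by move=> /submxP[c ->]; rewrite -mulmxA mulmxBr fP mulmx1 subrr mulmx0.
pose sigma x := E *m rho x *m D.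
have rhoD x : rho x *m D = D *m sigma x.
  have DE : (1%:M - D *m E) *m D = 0.
    by rewrite mulmxBl mul1mx -mulmxA ED mulmx1 subrr.
  have /eqP : (1%:M - D *m E) *m (rho x - 1%:M) = 0.
    apply/row_matrixP=> i; rewrite row_mul row0; apply: fixed; apply: kerD.
    by rewrite -row_mul DE row0.
  rewrite mulmxBr mulmx1 subr_eq0 => /eqP DEr.
  rewrite -[LHS]mul1mx -[X in X *m _](subrK (D *m E)) mulmxDl mulmxA DEr DE add0r.
  by rewrite /sigma !mulmxA.
clearbody sigma.
have Dinj (a b : 'M_(\rank (cokermx f))) : D *m a = D *m b -> a = b.
  by move=> h; rewrite -[a]mul1mx -[b]mul1mx -ED -!mulmxA h.
have [rho1 rhoM rhoU] := rhoP.
have sigmaX x m : D *m sigma x ^+ m = rho x ^+ m *m D.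
  elim: m => [|m IHm]; first by rewrite !expr0 mulmx1 mul1mx.
  by rewrite !exprS -!mulmxE mulmxA -rhoD -(mulmxA (rho x) (rho x ^+ m)) -IHm mulmxA.
have sigmaP : unip_rep sigma.
  split; first by apply: Dinj; rewrite -rhoD rho1 mul1mx mulmx1.
  - by move=> x y; apply: Dinj; rewrite mulmxA -!rhoD rhoM -mulmxA !rhoD mulmxA rhoD.
  - move=> x; have [l rl] := rhoU x; exists l.
    by apply: Dinj; rewrite sigmaX rl mul1mx mulmx1.
have [|m mP] := IH _ sigma _ sigmaP.
  by rewrite mxrank_coker rf subn1 -ltnS prednK.
have lift j w : killed sigma j (w *m D) -> killed rho j.+1 w.
  elim: j w => [|j IHj] w /=; first by move=> /kerD wf x; apply: fixed.
  move=> h x; apply: IHj; move: (h x).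
  by rewrite mulmxBr mulmx1 -mulmxA -rhoD mulmxBr mulmx1 mulmxBl mulmxA.
by exists m.+1 => w; apply: lift.
Qed.
End UnipotentRep.

(* An element [z <> 1] with [z - 1] as deep as possible in the filtration [J] by powers of
   the augmentation ideal is central, since [z w z^-1 w^-1 - 1] lies one step deeper. *)
Lemma unipotent_center (K : closedFieldType) (p n : nat) (Kp : p \in [pchar K])
    (V : set 'M[K]_n) :
    V 1 -> (forall x y, V x -> V y -> V (x * y)) -> (forall x, V x -> V (invmx x)) ->
    (forall x, V x -> x \in unitmx) ->
    (forall x, V x -> exists k, x ^+ (p ^ k) = 1) -> V <> [set 1] ->
  exists z, [/\ V z, z <> 1 & forall w, V w -> z * w = w * z].
Proof.
move=> V1 VM VV Vunit VU Vn1.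
pose X := {x | V x}.
pose opX (x y : X) : X := exist V (sval x * sval y) (VM _ _ (svalP x) (svalP y)).
have [//|m mP] := @unip_rep_killed K p X opX (exist V 1 V1) Kp n (fun x => sval x).
  by split=> // -[x Vx]; exact: VU.
set rho := (fun x : X => sval x) in mP.
pose J k (Y : 'M[K]_n) := forall j w, killed rho (j + k) w -> killed rho j (w *m Y).
have Jm Y : J m Y -> Y = 0.
  move=> JY; apply/row_matrixP=> i; rewrite row0 rowE.
  by have := JY 0%N (delta_mx 0 i) (mP _).
have J1 v : V v -> J 1%N (v - 1).
  by move=> Vv j w; rewrite addn1 => /(_ (exist V v Vv)).
have [v Vv v1] : exists2 v, V v & v <> 1.
  apply: contrapT => h; apply: Vn1; apply/seteqP; split=> x /=; last by move=> ->.
  by move=> Vx; apply: contrapT => x1; apply: h; exists x.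
pose good k := `[< exists v, [/\ V v, v <> 1 & J k.+1 (v - 1)] >].
have exg : exists k, good k by exists 0%N; apply/asboolP; exists v; split=> //; exact: J1.
have Jdec k l Y : (k <= l)%N -> J l Y -> J k Y.
  move=> kl JY j w h; apply: JY; rewrite -(subnKC kl) addnA.
  by elim: (l - k)%N => [|i IHi]; rewrite ?addn0 // addnS; exact: killedS.
have gle k : good k -> (k <= m)%N.
  move=> /asboolP[u [Vu u1 Ju]]; rewrite leqNgt; apply/negP=> mk; apply: u1.
  by apply/eqP; rewrite -subr_eq0; apply/eqP/Jm; apply: Jdec Ju; exact: leqW (ltnW mk).
have [k /asboolP[z [Vz z1 Jz]] kmax] := ex_maxnP exg gle.
exists z; split=> // w Vw.
have unit_zw := Vunit _ (VM _ _ Vw Vz).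
pose c := (z * w) * invmx (w * z).
have Vc : V c := VM _ _ (VM _ _ Vz Vw) (VV _ (VM _ _ Vw Vz)).
suff c1 : c = 1.
  have : c * (w * z) = w * z by rewrite c1 mul1r.
  by rewrite /c -!mulmxE mulmxKV.
apply: contrapT => c1; suff /kmax : good k.+1 by rewrite ltnn.
apply/asboolP; exists c; split=> // j u ku.
(* Depths add up in products: [z - 1] goes down [k.+1] steps, [w - 1] one step, and the factor
   [invmx (w * z)] preserves the filtration. *)
have -> : c - 1 = ((z - 1) *m (w - 1) - (w - 1) *m (z - 1)) *m invmx (w * z).
  have -> : (z - 1) *m (w - 1) - (w - 1) *m (z - 1) = z * w - w * z.
    rewrite !mulmxE -[in RHS](subrK 1 z) -[in RHS](subrK 1 w).
    move: (z - 1) (w - 1) => A B.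
    rewrite !mulrDl !mulrDr !mul1r !mulr1 -!(addrA (_ * _)).
    by rewrite [B + (A + 1)]addrCA opprD [- (B * A) - _]addrC addNKr.
  by rewrite mulmxBl /c; congr (_ - _); rewrite mulmxE -mulmxE mulmxV.
have Viw : V (invmx (w * z)) := VV _ (VM _ _ Vw Vz).
rewrite mulmxA; apply: (@killed_mul _ _ n rho j _ (exist V _ Viw)).
rewrite mulmxBr addrC -scaleN1r; apply: killed_lin.
  rewrite mulmxA; apply: Jz.
  by rewrite addnS in ku; exact: (ku (exist V w Vw)).
rewrite mulmxA.
have : killed rho j.+1 (u *m (z - 1)) by apply: Jz; rewrite addSnnS.
by move/(_ (exist V w Vw)).
Qed.

(** * Functions of finite degree on an abelian group *)

Section FunctionAlgebra.
Variable K : comNzRingType.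

(** Regular functions stay plain maps and polynomiality is this predicate: relations are then
    equalities of functions, and induction on the predicate replaces expansions into monomials. *)
Inductive alg (X : Type) (gen : set (X -> K)) : (X -> K) -> Prop :=
| AlgGen f : gen f -> alg gen f
| AlgConst c : alg gen (fun=> c)
| AlgAdd f g : alg gen f -> alg gen g -> alg gen (fun x => f x + g x)
| AlgMul f g : alg gen f -> alg gen g -> alg gen (fun x => f x * g x).

Lemma alg_eq X (gen : set (X -> K)) f g : alg gen f -> f =1 g -> alg gen g.
Proof. by move=> Rf /funext <-. Qed.

Lemma alg_scale X (gen : set (X -> K)) c f : alg gen f -> alg gen (fun x => c * f x).
Proof. by move=> Rf; apply: AlgMul => //; exact: AlgConst. Qed.

Lemma alg_opp X (gen : set (X -> K)) f : alg gen f -> alg gen (fun x => - f x).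
Proof. by move=> Rf; apply: (alg_eq (alg_scale (-1) Rf)) => x; rewrite mulN1r. Qed.

Lemma alg_sub X (gen : set (X -> K)) f g :
  alg gen f -> alg gen g -> alg gen (fun x => f x - g x).
Proof. by move=> Rf Rg; apply: AlgAdd => //; exact: alg_opp. Qed.

Lemma alg_exp X (gen : set (X -> K)) f n : alg gen f -> alg gen (fun x => f x ^+ n).
Proof.
move=> Rf; elim: n => [|n IH]; first exact: AlgConst.
by apply: (alg_eq (AlgMul Rf IH)) => x; rewrite exprS.
Qed.

Lemma alg_sum X (gen : set (X -> K)) (I : Type) (r : seq I) (P : pred I) (F : I -> X -> K) :
  (forall i, P i -> alg gen (F i)) -> alg gen (fun x => \sum_(i <- r | P i) F i x).
Proof.
move=> RF; elim: r => [|i r IH].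
  by apply: (alg_eq (AlgConst gen 0)) => x; rewrite big_nil.
case: (boolP (P i)) => Pi; last by apply: (alg_eq IH) => x; rewrite big_cons (negPf Pi).
by apply: (alg_eq (AlgAdd (RF _ Pi) IH)) => x; rewrite big_cons Pi.
Qed.

Lemma alg_prod X (gen : set (X -> K)) (I : Type) (r : seq I) (P : pred I) (F : I -> X -> K) :
  (forall i, P i -> alg gen (F i)) -> alg gen (fun x => \prod_(i <- r | P i) F i x).
Proof.
move=> RF; elim: r => [|i r IH].
  by apply: (alg_eq (AlgConst gen 1)) => x; rewrite big_nil.
case: (boolP (P i)) => Pi; last by apply: (alg_eq IH) => x; rewrite big_cons (negPf Pi).
by apply: (alg_eq (AlgMul (RF _ Pi) IH)) => x; rewrite big_cons Pi.
Qed.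

Lemma alg_comp X Y (gen : set (X -> K)) (gen' : set (Y -> K)) (h : Y -> X) f :
  (forall g, gen g -> alg gen' (g \o h)) -> alg gen f -> alg gen' (f \o h).
Proof.
move=> genh; elim=> [g /genh //|c|g1 g2 _ IH1 _ IH2|g1 g2 _ IH1 _ IH2].
- exact: AlgConst.
- exact: (AlgAdd IH1 IH2).
- exact: (AlgMul IH1 IH2).
Qed.

Lemma alg_trans X (gen gen' : set (X -> K)) f :
  (forall g, gen g -> alg gen' g) -> alg gen f -> alg gen' f.
Proof. exact: (@alg_comp X X gen gen' id). Qed.

Definition coord (I : Type) (i : I) : (I -> K) -> K := fun y => y i.

Lemma alg_factor X (I : Type) (b : I -> X -> K) f : alg (range b) f ->
  exists2 F, alg (range (@coord I)) F & f = fun x => F (b^~ x).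
Proof.
elim=> [_ [i _ <-]|c|f1 f2 _ [F1 A1 ->] _ [F2 A2 ->]|f1 f2 _ [F1 A1 ->] _ [F2 A2 ->]].
- by exists (coord i) => //; apply: AlgGen; exists i.
- by exists (fun=> c) => //; exact: AlgConst.
- by exists (fun y => F1 y + F2 y) => //; exact: AlgAdd.
- by exists (fun y => F1 y * F2 y) => //; exact: AlgMul.
Qed.

Lemma alg_subst X (I : Type) (b : I -> X -> K) gen F :
  (forall i, alg gen (b i)) -> alg (range (@coord I)) F -> alg gen (fun x => F (b^~ x)).
Proof. by move=> Rb; apply: (@alg_comp _ _ _ gen (fun x => b^~ x)) => _ [i _ <-]; exact: Rb. Qed.

Lemma alg_common_family X (gen : set (X -> K)) k1 k2 (b1 : 'I_k1 -> X -> K) (b2 : 'I_k2 -> X -> K) :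
    (forall i, gen (b1 i)) -> (forall i, gen (b2 i)) ->
  exists k (b : 'I_k -> X -> K), [/\ forall i, gen (b i),
    forall g, alg (range b1) g -> alg (range b) g &
    forall g, alg (range b2) g -> alg (range b) g].
Proof.
move=> g1 g2; exists (k1 + k2)%N.
exists (fun i => match fintype.split i with inl j => b1 j | inr j => b2 j end).
split=> [i|g|g]; first by case: fintype.split.
- by apply: alg_trans => _ [i _ <-]; apply: AlgGen; exists (lshift k2 i); rewrite // (unsplitK (inl i)).
- by apply: alg_trans => _ [i _ <-]; apply: AlgGen; exists (rshift k1 i); rewrite // (unsplitK (inr i)).
Qed.

Lemma alg_finite X (gen : set (X -> K)) f : alg gen f ->
  exists k (b : 'I_k -> X -> K), (forall i, gen (b i)) /\ alg (range b) f.
Proof.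
elim=> [g gg|c|f1 f2 _ [k1 [b1 [g1 a1]]] _ [k2 [b2 [g2 a2]]]|f1 f2 _ [k1 [b1 [g1 a1]]] _ [k2 [b2 [g2 a2]]]].
- by exists 1%N, (fun=> g); split=> //; apply: AlgGen; exists ord0.
- by exists 0%N, (fun=> fun=> 0); split; [case | exact: AlgConst].
- have [k [b [gb h1 h2]]] := alg_common_family g1 g2.
  by exists k, b; split=> //; apply: AlgAdd; [exact: h1 | exact: h2].
- have [k [b [gb h1 h2]]] := alg_common_family g1 g2.
  by exists k, b; split=> //; apply: AlgMul; [exact: h1 | exact: h2].
Qed.

(** The linear functional on [{poly K}] sending ['X^i] to [h i]. With [h i = f (t + u *+ i)] it
    expresses iterated differences, with [h i = y ^+ (p ^ i)] the values of p-polynomials. *)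
Definition psum (h : nat -> K) (q : {poly K}) := \sum_(i < size q) q`_i * h i.

Lemma psum_widen n h (q : {poly K}) : (size q <= n)%N -> psum h q = \sum_(i < n) q`_i * h i.
Proof.
move=> qn; rewrite /psum (big_ord_widen n (fun i => q`_i * h i) qn) big_mkcond.
apply: eq_bigr => i _; case: ltnP => // /(nth_default 0) ->.
by rewrite mul0r.
Qed.

Lemma psum_lin h a q r : psum h (a *: q + r) = a * psum h q + psum h r.
Proof.
pose n := maxn (size (a *: q + r)) (maxn (size q) (size r)).
rewrite !(@psum_widen n) ?leq_max ?leqnn ?orbT //.
by rewrite mulr_sumr -big_split; apply: eq_bigr => i _; rewrite coefD coefZ mulrDl mulrA.
Qed.

Lemma psum0 h : psum h 0 = 0.
Proof. by rewrite /psum size_poly0 big_ord0. Qed.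

Lemma psumD h q r : psum h (q + r) = psum h q + psum h r.
Proof. by rewrite -[q in LHS]scale1r psum_lin mul1r. Qed.

Lemma psumZ h a q : psum h (a *: q) = a * psum h q.
Proof. by rewrite -[_ *: _]addr0 psum_lin psum0 addr0. Qed.

Lemma psumN h q : psum h (- q) = - psum h q.
Proof. by rewrite -scaleN1r psumZ mulN1r. Qed.

Lemma psumXnM h k q : psum h ('X^k * q) = psum (fun i => h (k + i)%N) q.
Proof.
rewrite (@psum_widen (k + size q)); last first.
  by rewrite (leq_trans (size_polyMleq _ _)) // size_polyXn.
rewrite big_split_ord /= big1 ?add0r; last first.
  by move=> i _; rewrite coefXnM ltn_ord mul0r.
by apply: eq_bigr => i _; rewrite coefXnM ltnNge leq_addr addKn.
Qed.

Lemma psum1 h : psum h 1 = h 0%N.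
Proof. by rewrite /psum size_poly1 big_ord1 coef1 eqxx mul1r. Qed.

Lemma psumXn h k : psum h 'X^k = h k.
Proof.
by rewrite -['X^k]mulr1 psumXnM psum1 addn0.
Qed.
End FunctionAlgebra.

(** * Finite differences and degree *)

Section Differences.
Variables (K : fieldType) (T : zmodType).
Implicit Types (f g : T -> K) (B : set (T -> K)).

Definition additive_fun f := forall s t, f (s + t) = f s + f t.

Definition delta v f : T -> K := fun t => f (t + v) - f t.

(* Functions of degree at most [m] whose multilinear symbol has its slices in [B]. *)
Fixpoint symb_in B m f {struct m} : Prop :=
  match m with
  | 0 => forall t, f t = f 0
  | i.+1 => match i with
            | 0 => B (fun t => f t - f 0)
            | _ => forall v, symb_in B i (delta v f)
            end
  end.

Definition dle := symb_in additive_fun.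

Definition additive_space B :=
  [/\ forall f, B f -> additive_fun f, B (fun=> 0) &
      forall c f g, B f -> B g -> B (fun t => c * f t + g t)].

Lemma symb_inSS B m f :
  symb_in B m.+2 f = forall v, symb_in B m.+1 (delta v f).
Proof. by []. Qed.

Lemma additive_fun0 f : additive_fun f -> f 0 = 0.
Proof. by move=> fD; apply: (addrI (f 0)); rewrite -fD !addr0. Qed.

Lemma additive_funN f t : additive_fun f -> f (- t) = - f t.
Proof. by move=> fD; apply/eqP; rewrite -addr_eq0 -fD addNr additive_fun0. Qed.

Lemma additive_space_full : additive_space additive_fun.
Proof.
split=> // [s t|c f g fD gD s t]; first by rewrite addr0.
by rewrite fD gD mulrDr addrACA.
Qed.

Lemma symb_in_sub B B' m f : (forall g, B g -> B' g) -> symb_in B m f -> symb_in B' m f.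
Proof.
move=> BB'; elim: m f => // -[|m] IH f; first exact: BB'.
by move=> h v; apply: IH; exact: (h v).
Qed.

(** Differences of an invariant function are invariant, and in degree one the slice [f - f 0]
    vanishes at [u]. This is how flattening shrinks the space of slices. *)
Lemma symb_in_inv B m f u : symb_in B m f -> (forall t, f (t + u) = f t) ->
  symb_in (fun b => B b /\ b u = 0) m f.
Proof.
elim: m f => // -[|m] IH f; first by move=> h inv; split=> //; rewrite -(inv 0) add0r subrr.
move=> h inv v; apply: IH; first exact: (h v).
by move=> t; rewrite /delta addrAC !inv.
Qed.

Lemma symb_in0 m f : symb_in (fun b => b = fun=> 0) m.+1 f -> dle m f.
Proof.
elim: m f => [|m IH] f.
  by move=> /funeqP h t; apply/eqP; rewrite -subr_eq0; apply/eqP; exact: (h t).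
case: m IH => [|m] IH h; last by move=> v; apply: IH; exact: (h v).
move=> s t; have /eqP := IH _ (h t) s.
rewrite /delta add0r subr_eq => /eqP ->; ring.
Qed.

Section SymbolSpace.
Variable B : set (T -> K).
Hypothesis spB : additive_space B.

Lemma symb_in_lin m c f g :
  symb_in B m f -> symb_in B m g -> symb_in B m (fun t => c * f t + g t).
Proof.
have [_ _ Blin] := spB.
elim: m f g => [|[|m] IH] f g.
- by move=> hf hg t; rewrite hf hg.
- move=> hf hg /=; rewrite (_ : (fun _ => _) = fun t => c * (f t - f 0) + (g t - g 0)).
    exact: Blin.
  by apply/funext=> t; ring.
- move=> hf hg v; have -> : delta v (fun t => c * f t + g t) = fun t => c * delta v f t + delta v g t.
    by apply/funext=> t; rewrite /delta; ring.
  exact: IH.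
Qed.

Lemma symb_in_const m c : symb_in B m (fun=> c).
Proof.
have [_ B0 _] := spB.
elim: m c => [|[|m] IH] c //=.
  by rewrite (_ : (fun _ => _) = fun=> 0) //; apply/funext=> t; rewrite subrr.
move=> v; rewrite (_ : delta v (fun=> c) = fun=> 0); first exact: IH.
by apply/funext=> t; rewrite /delta subrr.
Qed.

Lemma symb_in_eq m f g : symb_in B m f -> f =1 g -> symb_in B m g.
Proof. by move=> hf fg; rewrite (_ : g = f) //; apply/funext=> t; rewrite fg. Qed.

Lemma symb_in_add m f g :
  symb_in B m f -> symb_in B m g -> symb_in B m (fun t => f t + g t).
Proof. by move=> hf hg; apply: (symb_in_eq (symb_in_lin 1 hf hg)) => t; rewrite mul1r. Qed.

Lemma symb_in_scale m c f : symb_in B m f -> symb_in B m (fun t => c * f t).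
Proof.
by move=> hf; apply: (symb_in_eq (symb_in_lin c hf (symb_in_const m 0))) => t; rewrite addr0.
Qed.

Lemma symb_in_sum (I : Type) (r : seq I) (P : pred I) m (F : I -> T -> K) :
  (forall i, P i -> symb_in B m (F i)) -> symb_in B m (fun t => \sum_(i <- r | P i) F i t).
Proof.
move=> RF; elim: r => [|i r IH].
  by apply: (symb_in_eq (symb_in_const m 0)) => t; rewrite big_nil.
case: (boolP (P i)) => Pi; last by apply: (symb_in_eq IH) => x; rewrite big_cons (negPf Pi).
by apply: (symb_in_eq (symb_in_add (RF _ Pi) IH)) => x; rewrite big_cons Pi.
Qed.

Lemma symb_in_delta m v f : symb_in B m.+1 f -> symb_in B m (delta v f).
Proof.
have [BD _ _] := spB.
case: m => [|m] hB; last exact: (hB v).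
move=> t; have /= /eqP := BD _ hB t v.
by rewrite subr_eq /delta add0r => /eqP ->; ring.
Qed.

Lemma symb_inS m f : symb_in B m f -> symb_in B m.+1 f.
Proof.
have [_ B0 _] := spB.
elim: m f => [|m IH] f h; first by rewrite /= (_ : (fun _ => _) = fun=> 0) //; apply/funext=> t; rewrite h subrr.
by move=> v; apply: IH; apply: symb_in_delta.
Qed.

Lemma symb_in_leq m l f : (m <= l)%N -> symb_in B m f -> symb_in B l f.
Proof.
move=> /subnKC <-; elim: (l - m)%N => [|i IH]; rewrite ?addn0 // addnS => h.
by apply: symb_inS; exact: IH.
Qed.

(** Leibniz rule for [delta v]: besides the two usual terms there is a product of two differences,
    of degree two less, so the induction is on [a + b]. *)
Lemma symb_in_mul a b f g :
  symb_in B a f -> symb_in B b g -> symb_in B (a + b) (fun t => f t * g t).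
Proof.
have [n] := ubnP (a + b); elim: n a b f g => // n IH [|a] b f g; rewrite ltnS => abn.
  by move=> hf hg; apply: (symb_in_eq (symb_in_scale (f 0) hg)) => t; rewrite [f t]hf.
case: b abn => [|b] abn hf.
  move=> hg; rewrite addn0; apply: (symb_in_eq (symb_in_scale (g 0) hf)) => t.
  by rewrite [g t]hg mulrC.
move=> hg; rewrite addSn in abn *; rewrite addnS symb_inSS => v.
have -> : delta v (fun t => f t * g t) = fun t => delta v f t * g t +
    (f t * delta v g t + delta v f t * delta v g t).
  by apply/funext=> t; rewrite /delta; ring.
have hfv := symb_in_delta v hf; have hgv := symb_in_delta v hg.
rewrite addnS in abn.
apply: symb_in_add; first by rewrite -addnS; apply: IH => //; rewrite addnS.
apply: symb_in_add; first by rewrite -addSn; apply: IH => //; rewrite addSn.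
by apply: symb_inS; apply: IH => //; exact: ltnW.
Qed.

Lemma symb_in_iter m k u f : (k <= m)%N -> symb_in B m f ->
  symb_in B (m - k) (iter k (delta u) f).
Proof.
elim: k => [|k IH]; first by rewrite subn0.
by move=> km h; apply: symb_in_delta; rewrite -subSn // subSS; apply: IH => //; exact: ltnW.
Qed.

Lemma symb_in_iter0 m k u f : (m < k)%N -> symb_in B m f ->
  iter k (delta u) f = fun=> 0.
Proof.
move=> /subnKC <- h; elim: (k - m.+1)%N => [|i IH].
  rewrite addn0 /=; apply/funext=> t; rewrite /delta.
  have := symb_in_iter u (leqnn m) h; rewrite subnn /= => c.
  by rewrite c [X in _ - X]c subrr.
by rewrite addnS iterS IH; apply/funext=> t; rewrite /delta subrr.
Qed.

Lemma symb_in_dle m f : symb_in B m f -> dle m f.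
Proof. by apply: symb_in_sub; case: spB. Qed.

End SymbolSpace.
End Differences.

(** * Binomial coefficients of field elements *)

Section BinomialCoefficient.
Variables (K : fieldType) (p : nat).
Hypothesis Kp : p \in [pchar K].

(** The binomial coefficient [y] over [k], meaningful for [k < p]; from [k = p] on, the division by
    [p%:R = 0] makes it zero. *)
Fixpoint binc (k : nat) (y : K) : K :=
  if k is i.+1 then binc i y * (y - i%:R) / k%:R else 1.

Lemma natr_lt_pchar k : (0 < k < p)%N -> k%:R != 0 :> K.
Proof.
move=> /andP[k0 kp]; rewrite -(dvdn_pcharf Kp); apply/negP => /(dvdn_leq k0).
by rewrite leqNgt kp.
Qed.

Lemma binc_pascal k y : (k.+1 < p)%N -> binc k.+1 y = binc k.+1 (y - 1) + binc k (y - 1).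
Proof.
move=> kp; have k0 : k.+1%:R != 0 :> K by exact: natr_lt_pchar.
have e : binc k y * (y - k%:R) = y * binc k (y - 1).
  elim: k {kp k0} => [|k IH] /=; first by rewrite subr0 mul1r mulr1.
  by rewrite IH -natr1; ring.
by apply: (mulIf k0); rewrite /= e mulrDl !divfK // -natr1; ring.
Qed.

(** Pascal's rule, summed. The boundary term is harmless for [n = p.-1] when [h p = 0], the case of
    iterated differences. *)
Lemma sum_binc_shift n (h : nat -> K) y : (n < p)%N ->
  \sum_(k < n.+1) binc k (y - 1) * (h k + h k.+1) =
  \sum_(k < n.+1) binc k y * h k + binc n (y - 1) * h n.+1.
Proof.
elim: n => [|n IH] np; first by rewrite !big_ord1 /=; ring.
rewrite big_ord_recr IH ?(ltnW np) // [in RHS]big_ord_recr [in RHS]/= -/(binc n.+1 y).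
rewrite [binc n.+1 y]binc_pascal //=; ring.
Qed.
End BinomialCoefficient.

(** * Generation of the regular functions by additive ones *)

Section Generation.
Variables (K : fieldType) (p : nat) (T : zmodType).
Hypothesis Kp : p \in [pchar K].
Hypothesis Tp : forall t : T, t *+ p = 0.
Implicit Types (f g : T -> K) (B : set (T -> K)).

(** [delta u] is translation by [u] minus the identity, so its powers are those of ['X - 1] with
    ['X] acting as the translation. *)
Lemma iter_delta u f k t :
  iter k (delta u) f t = psum (fun i => f (t + u *+ i)) (('X - 1) ^+ k : {poly K}).
Proof.
elim: k t => [|k IH] t.
  by rewrite expr0 psum1 mulr0n addr0.
rewrite exprS mulrBl mul1r psumD psumN -IH -['X]expr1 psumXnM /= /delta !IH.
by congr (psum _ _ - _); apply/funext=> i; rewrite mulrnDr addrA.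
Qed.

Lemma iter_delta_pchar u f : iter p (delta u) f = fun=> 0.
Proof.
apply/funext=> t; rewrite iter_delta.
have Pp : p \in [pchar {poly K}] by rewrite pchar_poly.
have pn : [pchar {poly K}].-nat p by rewrite pnatE // (pcharf_prime Kp).
rewrite exprDn_pchar // exprNn_pchar // expr1n psumD psumN psumXn psum1.
by rewrite Tp mulr0n subrr.
Qed.

(* The Taylor expansion (1 + delta u)^(-e) f, which is invariant under
   translation by u when e (u) = 1. *)
Definition flatten (e : T -> K) (u : T) f : T -> K :=
  fun t => \sum_(k < p) binc k (- e t) * iter k (delta u) f t.

(** Translation by [u] turns [- e t] into [- e t - 1] and the k-th difference into its sum with the
    next one. Pascal's rule restores the original sum, the boundary term being a p-th difference. *)
Lemma flatten_inv e u f t : additive_fun e -> e u = 1 ->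
  flatten e u f (t + u) = flatten e u f t.
Proof.
move=> eD eu; rewrite /flatten eD eu opprD.
have pE : p.-1.+1 = p by rewrite prednK // prime_gt0 // (pcharf_prime Kp).
transitivity (\sum_(k < p) binc k (- e t - 1) * (iter k (delta u) f t + iter k.+1 (delta u) f t)).
  apply: eq_bigr => k _; congr (_ * _); rewrite -[LHS](subrK (iter k (delta u) f t)).
  by rewrite addrC.
have := @sum_binc_shift K p Kp p.-1 (fun k => iter k (delta u) f t) (- e t).
by rewrite pE iter_delta_pchar mulr0 addr0; apply.
Qed.

Lemma symb_in_binc B e k : additive_space B -> B e -> symb_in B k (fun t => binc k (- e t)).
Proof.
move=> spB Be; elim: k => [|k IH]; first exact: symb_in_const.
have s1 : symb_in B 1 (fun t => k.+1%:R^-1 * (- e t - k%:R)).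
  apply: symb_in_scale => //; apply: symb_in_add => //; last exact: symb_in_const.
  apply: (symb_in_eq (symb_in_scale spB (-1) (_ : symb_in B 1 e))) => [|t]; last by rewrite mulN1r.
  have [BD _ _] := spB.
  rewrite /= (_ : (fun _ => _) = e) //; apply/funext=> t.
  by rewrite (additive_fun0 (BD _ Be)) subr0.
rewrite -addn1; apply: (symb_in_eq (symb_in_mul spB IH s1)) => t.
by rewrite addn1 /= mulrCA mulrC.
Qed.

Lemma symb_in_flatten B e u m f : additive_space B -> B e ->
  symb_in B m f -> symb_in B m (flatten e u f).
Proof.
move=> spB Be hf; apply: symb_in_sum => // k _.
have [km|mk] := leqP k m; last first.
  rewrite (symb_in_iter0 spB u mk hf).
  by apply: (symb_in_eq (symb_in_const spB m 0)) => t; rewrite mulr0.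
rewrite -{1}(subnKC km); apply: symb_in_mul => //; first exact: symb_in_binc.
exact: symb_in_iter.
Qed.

Definition lspan (k : nat) (l : 'I_k -> T -> K) : set (T -> K) :=
  [set f | exists c : 'I_k -> K, f = fun t => \sum_i c i * l i t].

Lemma lspan_lin k (l : 'I_k -> T -> K) c f g :
  lspan l f -> lspan l g -> lspan l (fun t => c * f t + g t).
Proof.
move=> [a ->] [b ->]; exists (fun i => c * a i + b i); apply/funext=> t.
by rewrite mulr_sumr -big_split; apply: eq_bigr => i _; rewrite mulrDl mulrA.
Qed.

Lemma lspan0 k (l : 'I_k -> T -> K) : lspan l (fun=> 0).
Proof. by exists (fun=> 0); apply/funext=> t; rewrite big1 // => i _; rewrite mul0r. Qed.

Lemma lspan_eval0 k (l : 'I_k.+1 -> T -> K) u : (exists i, l i u != 0) ->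
  exists l' : 'I_k -> T -> K, forall f, lspan l f -> f u = 0 -> lspan l' f.
Proof.
move=> [i liu]; exists (fun j t => l (lift i j) t - l (lift i j) u / l i u * l i t).
move=> _ [c ->] /eqP; rewrite (bigD1_ord i) //= addr_eq0 => /eqP cE.
exists (fun j => c (lift i j)); apply/funext=> t; rewrite (bigD1_ord i) //=.
have -> : c i = - (\sum_j c (lift i j) * l (lift i j) u) / l i u by rewrite -cE mulfK.
rewrite -mulrA mulNr mulr_suml -sumrN -big_split; apply: eq_bigr => j _ /=.
by rewrite mulrBr addrC; congr (_ - _); ring.
Qed.

Variable gen : set (T -> K).
Local Notation R := (alg gen).
Hypothesis gen_shift : forall v g, gen g -> R (fun t => g (t + v)).
Hypothesis gen_fin : forall g, gen g ->
  exists k (l : 'I_k -> T -> K), forall v, lspan l (fun t => g (t + v)).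
Hypothesis gen_deg : forall g, gen g -> exists m, dle m g.

Lemma alg_shift v f : R f -> R (fun t => f (t + v)).
Proof. by apply: (@alg_comp _ _ _ gen gen (fun t => t + v)) => g; exact: gen_shift. Qed.

Lemma alg_delta v f : R f -> R (delta v f).
Proof. by move=> Rf; apply: alg_sub => //; exact: alg_shift. Qed.

Lemma alg_iter_delta v f k : R f -> R (iter k (delta v) f).
Proof. by move=> Rf; elim: k => // k IH; exact: alg_delta. Qed.

Lemma alg_deg f : R f -> exists m, dle m f.
Proof.
have spA := additive_space_full K T.
elim=> [g /gen_deg //|c|g h _ [a ga] _ [b hb]|g h _ [a ga] _ [b hb]].
- by exists 0%N.
- exists (maxn a b); apply: symb_in_add => //.
    exact: symb_in_leq (leq_maxl _ _) ga.
  exact: symb_in_leq (leq_maxr _ _) hb.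
- by exists (a + b)%N; apply: symb_in_mul.
Qed.

Lemma alg_fin f : R f ->
  exists k (l : 'I_k -> T -> K), forall v, lspan l (fun t => f (t + v)).
Proof.
elim=> [g /gen_fin //|c|g h _ [a [l lP]] _ [b [l' l'P]]|g h _ [a [l lP]] _ [b [l' l'P]]].
- by exists 1%N, (fun=> fun=> 1) => v; exists (fun=> c); apply/funext=> t; rewrite big_ord1 mulr1.
- exists (a + b)%N, (fun i => match fintype.split i with inl j => l j | inr j => l' j end) => v.
  have [c cE] := lP v; have [c' c'E] := l'P v.
  exists (fun i => match fintype.split i with inl j => c j | inr j => c' j end); apply/funext=> t.
  have /= -> := congr1 (fun f => f t) cE; have /= -> := congr1 (fun f => f t) c'E.
  rewrite big_split_ord /=; congr (_ + _); apply: eq_bigr => i _.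
    by rewrite (unsplitK (inl i)).
  by rewrite (unsplitK (inr i)).
- exists #|{: 'I_a * 'I_b}|, (fun i t => l (enum_val i).1 t * l' (enum_val i).2 t) => v.
  have [c cE] := lP v; have [c' c'E] := l'P v.
  exists (fun i => c (enum_val i).1 * c' (enum_val i).2); apply/funext=> t.
  have /= -> := congr1 (fun f => f t) cE; have /= -> := congr1 (fun f => f t) c'E.
  rewrite big_distrlr pair_bigA (reindex (@enum_val _ {: 'I_a * 'I_b})) /=; last first.
    exact/onW_bij/enum_val_bij.
  by apply: eq_bigr => i _; rewrite mulrACA.
Qed.

Definition addR : set (T -> K) := [set f | additive_fun f /\ R f].

Lemma addR_space k (l : 'I_k -> T -> K) :
  additive_space [set f | addR f /\ lspan l f].
Proof.
split=> [f [[]] //| |c f g [[fD Rf] lf] [[gD Rg] lg]].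
  by split; [split=> [s t|]; [rewrite addr0 | exact: AlgConst] | exact: lspan0].
split; last exact: lspan_lin.
split; last by apply: AlgAdd => //; exact: alg_scale.
by have [_ _] := additive_space_full K T; apply.
Qed.

(** Induction on the number [k] of functions spanning the slices. If some slice has [e u = 1], the
    slices of [flatten e u f] vanish at [u] and lie in the span of one function less, while the
    later Taylor terms are polynomials in [e] times differences of [f], of smaller degree. If there
    is no such slice, all slices are zero by scaling and the degree of [f] drops. *)
Lemma alg_generated_of_symb m k (l : 'I_k -> T -> K) f :
    (forall g, R g -> dle m g -> alg addR g) ->
  R f -> symb_in [set g | addR g /\ lspan l g] m.+1 f -> alg addR f.
Proof.
move=> IHm; elim: k l f => [|k IHk] l f Rf hf.
  apply: IHm => //; apply: symb_in0; apply: symb_in_sub hf => g [_ [c ->]].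
  by apply/funext=> t; rewrite big_ord0.
have spB := addR_space l; set B := [set g | _] in hf spB.
have [[e [u [Be eu]]]|B0] := pselect (exists e u, B e /\ e u = 1); last first.
  apply: IHm => //; apply: symb_in0; apply: symb_in_sub hf => g Bg.
  apply/funext=> t; apply/eqP; apply: contraT => gt; case: B0.
  exists (fun s => (g t)^-1 * g s + 0), t; split; last by rewrite addr0 mulVf.
  by have [_ B0 Blin] := spB; apply: Blin.
have [[eD Re] le] := Be.
have Rflat : R (flatten e u f).
  apply: alg_sum => k' _; apply: AlgMul; last exact: alg_iter_delta.
  elim: (k' : nat) => [|i IHi]; first exact: AlgConst.
  apply: (alg_eq (alg_scale i.+1%:R^-1 (AlgMul IHi (AlgAdd (alg_opp Re) (AlgConst _ (- i%:R)))))).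
  by move=> t /=; rewrite mulrC.
have flatI := symb_in_inv (symb_in_flatten u spB Be hf) (fun t => flatten_inv f t eD eu).
have [|l' l'P] := @lspan_eval0 _ l u.
  apply: contrapT => l0; have [c eE] := le.
  have : e u = 0.
    rewrite eE big1 // => i _; have [->|li] := eqVneq (l i u) 0; first by rewrite mulr0.
    by case: l0; exists i.
  by rewrite eu => /eqP; rewrite oner_eq0.
have Aflat : alg addR (flatten e u f).
  apply: (IHk l') => //; apply: symb_in_sub flatI => g [[Ag lg] gu].
  by split=> //; exact: l'P.
have Ae : alg addR e by apply: AlgGen.
have p0 : (0 < p)%N by rewrite prime_gt0 // (pcharf_prime Kp).
pose h t := \sum_(j < p | (0 < j)%N) binc j (- e t) * iter j (delta u) f t.
have Ah : alg addR h.
  apply: alg_sum => j j0; apply: AlgMul.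
    elim: (j : nat) => [|i IHi]; first exact: AlgConst.
    apply: (alg_eq (alg_scale i.+1%:R^-1 (AlgMul IHi (AlgAdd (alg_opp Ae) (AlgConst _ (- i%:R)))))).
    by move=> t /=; rewrite mulrC.
  apply: IHm; first exact: alg_iter_delta.
  have dlef := symb_in_dle spB hf.
  case: j j0 => [[|j] jp] //= _.
  have spA := additive_space_full K T.
  have [jm|mj] := leqP j m; last first.
    by rewrite -/(iter j.+1 (delta u) f) (symb_in_iter0 spA u _ dlef) //; exact: symb_in_const.
  by apply: (@symb_in_leq _ _ _ spA (m - j)%N); rewrite ?leq_subr // -subSS; apply: (symb_in_iter spA u _ dlef).
apply: (alg_eq (alg_sub Aflat Ah)) => t.
rewrite /flatten /h (bigD1 (Ordinal p0)) //= mul1r.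
by rewrite (eq_bigl (fun j : 'I_p => 0 < j)%N) ?addrK // => j; rewrite -val_eqE /= lt0n.
Qed.

Theorem alg_generated_by_additive f : R f -> alg addR f.
Proof.
move=> Rf; have [m] := alg_deg Rf; elim: m f Rf => [|m IHm] f Rf df.
  by apply: (alg_eq (AlgConst _ (f 0))) => t; rewrite [f t]df.
have [k [l lP]] := alg_fin Rf.
(* The constant 1 is adjoined to the span of the translates because a slice in degree one is
   [f - f 0], not [f]. *)
pose l1 : 'I_k.+1 -> T -> K := fun i => if unlift ord0 i is Some j then l j else fun=> 1.
apply: (@alg_generated_of_symb m _ l1) => //.
have ll1 c g : lspan l g -> lspan l1 (fun t => g t + c).
  move=> [a ->]; exists (fun i => if unlift ord0 i is Some j then a j else c).
  apply/funext=> t; rewrite big_ord_recl /l1 unlift_none mulr1 addrC; congr (_ + _).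
  by apply: eq_bigr => i _; rewrite liftK.
elim: m {IHm} f Rf df lP => [|m IH] f Rf df lP.
  split; last by apply: ll1; have := lP 0; under [X in lspan _ X]eq_fun do rewrite addr0.
  by split=> //; apply: alg_sub => //; exact: AlgConst.
rewrite symb_inSS => v; apply: IH; [exact: alg_delta | exact: df |].
move=> w; have := lspan_lin (-1) (lP w) (lP (w + v)).
by congr lspan; apply/funext=> t; rewrite /delta mulN1r addrC addrA.
Qed.

End Generation.

(** * p-polynomials *)

Section PPolynomials.
Variables (K : closedFieldType) (p : nat).
Hypothesis Kp : p \in [pchar K].

Lemma poly_eq0_of_horner (q : {poly K}) : (forall x, q.[x] = 0) -> q = 0.
Proof.
move=> q0; have : size (q + 1) == 1%N.
  apply: contraT => /closed_rootP[x]; rewrite /root hornerD q0 hornerC add0r.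
  by rewrite oner_eq0.
move=> /size_poly1P[c _ qE]; have := q0 0; have /(canRL (addrK _)) -> := qE.
rewrite hornerD hornerN !hornerC => c1.
by rewrite -polyCN -polyCD c1.
Qed.

Lemma expr_pX_inj k : injective (fun x : K => x ^+ (p ^ k)).
Proof.
move=> x y /eqP; rewrite -subr_eq0.
have pn : [pchar K].-nat (p ^ k)%N by rewrite pnatX pnatE ?Kp // (pcharf_prime Kp).
by rewrite -exprNn_pchar // -exprDn_pchar // expf_eq0 subr_eq0 => /andP[_ /eqP].
Qed.

Lemma proot_exists k (y : K) : exists x, x ^+ (p ^ k) = y.
Proof.
have p0 : (0 < p ^ k)%N by rewrite expn_gt0 prime_gt0 // (pcharf_prime Kp).
have /closed_rootP[x] : size ('X^(p ^ k) - y%:P) != 1%N.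
  by rewrite size_XnsubC // eqSS -lt0n.
by rewrite /root hornerD hornerN hornerXn hornerC subr_eq0 => /eqP; exists x.
Qed.

Definition proot k y := sval (cid (proot_exists k y)).

Lemma prootK k y : proot k y ^+ (p ^ k) = y.
Proof. exact: (svalP (cid (proot_exists k y))). Qed.

Lemma exprD_pX k (x y : K) : (x + y) ^+ (p ^ k) = x ^+ (p ^ k) + y ^+ (p ^ k).
Proof. by rewrite exprDn_pchar // pnatX pnatE ?Kp // (pcharf_prime Kp). Qed.

Lemma expr0_pX k : 0 ^+ (p ^ k) = 0 :> K.
Proof. by rewrite expr0n expn_eq0 -leqn0 leqNgt prime_gt0 // (pcharf_prime Kp). Qed.

Lemma expr_sum_pX k (I : Type) (r : seq I) (P : pred I) (F : I -> K) :
  (\sum_(i <- r | P i) F i) ^+ (p ^ k) = \sum_(i <- r | P i) F i ^+ (p ^ k).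
Proof. by apply: (big_morph (fun x => x ^+ (p ^ k))); [exact: exprD_pX | exact: expr0_pX]. Qed.

(* [pev a y] is the value at [y] of the p-polynomial [\sum_i a_i y^(p^i)]: the
   polynomial [a] encodes an element of the twisted polynomial ring K[F]. *)
Definition pev (a : {poly K}) (y : K) := psum (fun i => y ^+ (p ^ i)) a.

Lemma pevD a y z : pev a (y + z) = pev a y + pev a z.
Proof. by rewrite /pev /psum -big_split; apply: eq_bigr => i _; rewrite exprD_pX mulrDr. Qed.

Lemma pev0 a : pev a 0 = 0.
Proof. by apply: (addrI (pev a 0)); rewrite -pevD !addr0. Qed.

Lemma pevC c y : pev c%:P y = c * y.
Proof. by rewrite -[c%:P]mulr1 mul_polyC /pev psumZ psum1 expn0 expr1. Qed.

(* [pcomp c k a] encodes the composite of [a] with [c F^k]. *)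
Definition pcomp c k (a : {poly K}) : {poly K} :=
  'X^k * \poly_(i < size a) (a`_i * c ^+ (p ^ i)).

Lemma pev_comp c k a y : pev (pcomp c k a) y = pev a (c * y ^+ (p ^ k)).
Proof.
rewrite /pev psumXnM (psum_widen _ (size_poly _ _)); apply: eq_bigr => i _.
by rewrite coef_poly ltn_ord exprMn -exprM -expnD mulrA.
Qed.

(* [pfrob k a] encodes the composite of [F^k] with [a]. *)
Definition pfrob k (a : {poly K}) : {poly K} :=
  'X^k * \poly_(i < size a) (a`_i ^+ (p ^ k)).

Lemma pev_frob k a y : pev (pfrob k a) y = pev a y ^+ (p ^ k).
Proof.
rewrite /pev psumXnM (psum_widen _ (size_poly _ _)) /psum expr_sum_pX.
apply: eq_bigr => i _.
by rewrite coef_poly ltn_ord exprMn -exprM -expnD addnC.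
Qed.

Lemma size_pcomp c k a : c != 0 -> a != 0 -> size (pcomp c k a) = (k + size a)%N.
Proof.
move=> c0 a0; have e : size (\poly_(i < size a) (a`_i * c ^+ (p ^ i))) = size a.
  rewrite size_poly_eq // -lead_coefE mulf_neq0 ?lead_coef_eq0 //.
  by rewrite expf_neq0.
rewrite /pcomp mulrC size_mulXn; last by rewrite -size_poly_gt0 e size_poly_gt0.
by rewrite e.
Qed.

Lemma lead_coef_pcomp c k a : c != 0 -> a != 0 ->
  lead_coef (pcomp c k a) = lead_coef a * c ^+ (p ^ (size a).-1).
Proof.
move=> c0 a0; rewrite lead_coefE size_pcomp // /pcomp coefXnM.
have sa : (0 < size a)%N by rewrite size_poly_gt0.
have -> : (k + size a).-1 = (k + (size a).-1)%N by rewrite -[in LHS](prednK sa) addnS.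
by rewrite ltnNge leq_addr /= addKn coef_poly ltn_predL sa lead_coefE.
Qed.

(* The derivative of [q] is constant; after subtraction of a linear term it vanishes, so what
   remains is the p-th power of an additive polynomial of smaller degree. *)
Lemma additive_horner (q : {poly K}) : (forall x y, q.[x + y] = q.[x] + q.[y]) ->
  exists a, forall x, q.[x] = pev a x.
Proof.
have pgt1 : (1 < p)%N by rewrite prime_gt1 // (pcharf_prime Kp).
have [n] := ubnP (size q); elim: n q => // n IH q sq qD.
pose c := q^`().[0].
have q'E : q^`() = c%:P.
  apply/eqP; rewrite -subr_eq0; apply/eqP/poly_eq0_of_horner => y.
  have qy : q \Po ('X + y%:P) = q + q.[y]%:P.
    apply/eqP; rewrite -subr_eq0; apply/eqP/poly_eq0_of_horner => x.
    by rewrite !(hornerD, hornerN) horner_comp !(hornerD, hornerX, hornerC) qD subrr.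
  have := congr1 (fun r : {poly K} => r^`().[0]) qy.
  rewrite deriv_comp !derivD derivX !derivC !addr0 mulr1 horner_comp.
  by rewrite !(hornerD, hornerN, hornerX, hornerC) add0r => ->; rewrite subrr.
pose r := q - c *: 'X.
have r'0 : r^`() = 0 by rewrite derivB derivZ derivX q'E alg_polyC subrr.
have rD x y : r.[x + y] = r.[x] + r.[y].
  by rewrite !(hornerD, hornerN, hornerZ, hornerX) qD; ring.
have [r0|r0] := eqVneq r 0.
  exists c%:P => x; rewrite pevC; have := congr1 (fun s : {poly K} => s.[x]) r0.
  by rewrite !(hornerD, hornerN, hornerZ, hornerX) horner0 => /eqP; rewrite subr_eq0 => /eqP.
have rcoef i : ~~ (p %| i)%N -> r`_i = 0.
  case: i => [|i pi]; first by rewrite dvdn0.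
  have := congr1 (fun s : {poly K} => s`_i) r'0; rewrite coef_deriv coef0 => /eqP.
  rewrite -mulr_natr mulf_eq0 => /orP[/eqP //|].
  by rewrite -(dvdn_pcharf Kp) (negPf pi).
have p0 := ltnW pgt1; set m := (size r).-1.
have sr : size r = m.+1 by rewrite prednK // size_poly_gt0.
pose s' := \poly_(i < (m %/ p).+1) r`_(i * p).
have rE : r = s' \Po 'X^p.
  apply/polyP => i; rewrite coef_comp_poly_Xn //.
  case: ifPn => [/dvdnP[j ->]|/rcoef //]; rewrite mulnK // coef_poly ltnS.
  rewrite leq_divRL //; case: ifPn => //; rewrite -ltnNge => mj.
  by rewrite nth_default // sr.
(* [r] has neither constant nor linear term, so its size exceeds 2; this ensures below that
   subtracting [c *: 'X] did not enlarge [q]. *)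
have m2 : (1 < m)%N.
  have rm : r`_m != 0 by rewrite -lead_coefE lead_coef_eq0.
  rewrite ltnNge; apply: contraNN rm => m1; apply/eqP.
  have : (m == 0)%N || (m == 1)%N by case: m m1 {s' sr rE} => [|[]].
  case/orP => /eqP ->; last by apply: rcoef; rewrite dvdn1 gtn_eqF.
  by rewrite -horner_coef0; apply: (addrI r.[0]); rewrite -rD !addr0.
pose s := \poly_(i < (m %/ p).+1) proot 1 r`_(i * p).
have sE x : s.[x] ^+ (p ^ 1) = r.[x].
  rewrite rE horner_comp hornerXn !horner_poly expr_sum_pX; apply: eq_bigr => i _.
  by rewrite exprMn prootK -!exprM expn1 mulnC.
have [||a aE] := IH s.
- rewrite ltnS in sq; apply: leq_ltn_trans (size_poly _ _) _; apply: leq_trans sq.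
  have rq : (size r <= size q)%N.
    have : (size r <= maxn (size q) 2)%N.
      rewrite (leq_trans (size_polyD _ _)) // size_polyN geq_max leq_maxl /=.
      by rewrite (leq_trans (size_scale_leq _ _)) // size_polyX leq_maxr.
    by rewrite leq_max => /orP[//|]; rewrite sr ltnS leqNgt m2.
  by apply: leq_trans rq; rewrite sr ltnS ltn_Pdiv // ltnW.
- by move=> x y; apply: (@expr_pX_inj 1); rewrite exprD_pX !sE rD.
exists (c%:P + pfrob 1 a) => x; rewrite /pev psumD -!/(pev _ _) pevC pev_frob -aE sE.
by rewrite !(hornerD, hornerN, hornerZ, hornerX) addrC subrK.
Qed.
End PPolynomials.

(** * Additive polynomial functions on affine space *)

Section AffineSpace.
Variables (K : closedFieldType) (p : nat).
Hypothesis Kp : p \in [pchar K].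
Variable r : nat.
Local Notation Kr := ('I_r -> K).
Local Notation polyfun := (alg (range (@coord K 'I_r))).

Lemma polyfun_shift v F : polyfun F -> polyfun (fun y : Kr => F (y + v)).
Proof.
apply: alg_comp => _ [i _ <-].
have ci : polyfun (coord i) by apply: AlgGen; exists i.
by apply: (alg_eq (AlgAdd ci (AlgConst _ (v i)))) => y; rewrite /coord /= addrfctE.
Qed.

Lemma polyfun_deg F : polyfun F -> exists m, dle m (F : Kr -> K).
Proof.
apply: alg_deg => _ [i _ <-]; exists 1%N => s t.
by rewrite /= /coord (_ : (0 : Kr) i = 0) // !subr0.
Qed.

Lemma polyfun_line (c : Kr) F : polyfun F ->
  exists q : {poly K}, forall s, F (fun i => s * c i) = q.[s].
Proof.
elim=> [_ [i _ <-]|c0|f g _ [a aE] _ [b bE]|f g _ [a aE] _ [b bE]].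
- by exists (c i *: 'X) => s; rewrite hornerZ hornerX mulrC.
- by exists c0%:P => s; rewrite hornerC.
- by exists (a + b) => s; rewrite hornerD aE bE.
- by exists (a * b) => s; rewrite hornerM aE bE.
Qed.

(** An additive function is the sum of its restrictions to the coordinate axes, which are additive
    polynomials in one variable. *)
Lemma additive_polyfun F : polyfun F -> additive_fun (F : Kr -> K) ->
  exists a : 'I_r -> {poly K}, forall y, F y = \sum_i pev p (a i) (y i).
Proof.
move=> PF FD.
pose e (i : 'I_r) : Kr := fun j => (j == i)%:R.
have FE (y : Kr) : F y = \sum_i F (fun j => y i * e i j).
  have yE : y = \sum_i (fun j => y i * e i j).
    apply/funext=> j; rewrite fct_sumE (bigD1 j) //= /e eqxx mulr1 big1 ?addr0 //.
    by move=> i /negPf ij; rewrite eq_sym ij mulr0.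
  have FS (s : seq 'I_r) (G : 'I_r -> Kr) : F (\sum_(i <- s) G i) = \sum_(i <- s) F (G i).
    exact: (big_morph F FD (additive_fun0 FD)).
  by rewrite {1}yE FS.
have aP i : exists a, forall s, F (fun j => s * e i j) = pev p a s.
  have [q qE] := polyfun_line (e i) PF.
  have [|a aE] := additive_horner Kp (q := q).
    move=> x y; rewrite -!qE -FD; congr F; apply/funext=> j.
    by rewrite mulrDl.
  by exists a => s; rewrite qE aE.
exists (fun i => sval (cid (aP i))) => y; rewrite FE; apply: eq_bigr => i _.
exact: (svalP (cid (aP i))).
Qed.
End AffineSpace.

(** * Free families over K[F] *)

Section FreeFamilies.
Variables (K : closedFieldType) (p : nat) (T : zmodType).
Hypothesis Kp : p \in [pchar K].

Definition pfree r (b : 'I_r -> T -> K) := forall a : 'I_r -> {poly K},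
  (forall t, \sum_i pev p (a i) (b i t) = 0) -> forall i, a i = 0.

(* A polynomial of minimal degree vanishing on the image of [T] is additive. *)
Lemma pfree_dense r (b : 'I_r -> T -> K) F :
    (forall i, additive_fun (b i)) -> pfree b -> alg (range (@coord K 'I_r)) F ->
  (forall t, F (b^~ t) = 0) -> forall y, F y = 0.
Proof.
move=> bD bfree PF; have [m] := polyfun_deg PF.
have bvD s t : (fun i => b i (s + t)) = (fun i => b i s) + (fun i => b i t).
  by apply/funext=> i; rewrite addrfctE bD.
have bv0 : (fun i => b i 0) = 0 by apply/funext=> i; rewrite (additive_fun0 (bD i)).
have spA := additive_space_full K ('I_r -> K : zmodType).
elim: m F PF => [|m IH] F PF dF Fb y.
  by rewrite [F y]dF -bv0; exact: (Fb 0).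
(* The image of [T] is a subgroup on which [F] vanishes, so [delta (b^~ t) F] vanishes there too, in
   smaller degree. The resulting invariance makes [delta z F - F z] vanish on the image, which gives
   additivity. *)
have inv t z : F (z + b^~ t) = F z.
  apply/eqP; rewrite -subr_eq0; apply/eqP.
  apply: (IH (delta (b^~ t) F)); [|exact: symb_in_delta|].
    by apply: alg_sub => //; exact: polyfun_shift.
  by move=> s; rewrite /delta -bvD !Fb subrr.
have FD : additive_fun (F : ('I_r -> K) -> K).
  move=> z w; apply/eqP; rewrite [z + w]addrC [F z + _]addrC -subr_eq -subr_eq0; apply/eqP.
  rewrite addrAC; apply: (IH (fun x => delta z F x - F z)).
  - by apply: alg_sub; [apply: alg_sub => //; exact: polyfun_shift | exact: AlgConst].
  - apply: symb_in_add => //; first exact: symb_in_delta.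
    exact: symb_in_const.
  - by move=> t; rewrite /delta Fb subr0 [X in F X]addrC inv subrr.
have [a aE] := additive_polyfun Kp PF FD.
have a0 := bfree a (fun t => etrans (esym (aE _)) (Fb t)).
by rewrite aE big1 // => i _; rewrite a0 /pev psum0.
Qed.

Lemma size_sub_lead_coef (q r : {poly K}) : size q = size r ->
  lead_coef q = lead_coef r -> q != 0 -> (size (q - r)%R < size q)%N.
Proof.
move=> sE lE q0; have sq : (0 < size q)%N by rewrite size_poly_gt0.
rewrite -(prednK sq) ltnS; apply/leq_sizeP => j; rewrite leq_eqVlt => /orP[/eqP <-|jq].
  by rewrite coefB -lead_coefE lE lead_coefE sE subrr.
by rewrite coefB !nth_default ?subrr // -?sE -(prednK sq).
Qed.

Variable gen : set (T -> K).
Local Notation R := (alg gen).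
Hypothesis torsion_free : forall f, addR gen f -> forall a : {poly K}, a != 0 ->
  (forall t, pev p a (f t) = 0) -> forall t, f t = 0.

Definition generates r (b : 'I_r -> T -> K) :=
  (forall i, addR gen (b i)) /\ forall g, gen g -> alg (range b) g.

(** Euclidean reduction of a relation in a family of least length. While two coefficients are
    nonzero, replacing [b l] by [b l + c * b k ^+ (p ^ m)] cancels the leading term of the longer
    one and keeps a generating family. A single remaining coefficient makes some [b i] torsion,
    hence zero, and dropping it contradicts minimality. *)
Lemma generates_pfree : (exists r (b : 'I_r -> T -> K), generates b) ->
  exists r (b : 'I_r -> T -> K), generates b /\ pfree b.
Proof.
move=> exb; pose good r := `[< exists b : 'I_r -> T -> K, generates b >].
have exg : exists r, good r by have [r [b gb]] := exb; exists r; apply/asboolP; exists b.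
have [r /asboolP[b gb] rmin] := ex_minnP exg.
exists r, b; split=> // a rel; apply: contrapT => /existsNP a0.
have {a0} [i ai] : exists i, a i != 0 by have [i ai] := a0; exists i; apply/eqP.
have [n] := ubnP (\sum_j size (a j)).
elim: n b gb a rel i ai => // n IH b gb a rel i ai; rewrite ltnS => an.
have [[j0 ji aj]|others] := pselect (exists2 j, j != i & a j != 0); last first.
  have bi0 : forall t, b i t = 0.
    apply: (torsion_free (gb.1 i) ai) => t; rewrite -(rel t) (bigD1 i) //= big1 ?addr0 //.
    move=> j ji; have [->|aj] := eqVneq (a j) 0; first by rewrite /pev psum0.
    by case: others; exists j.
  case: r b gb a rel i ai an rmin bi0 others {IH} => [|r] b gb a rel i; first by case: i.
  move=> _ _ rmin bi0 _; suff /rmin : good r by rewrite ltnn.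
  apply/asboolP; exists (fun j => b (lift i j)); split=> [j|g gg]; first exact: gb.1.
  apply: alg_trans (gb.2 _ gg) => _ [j _ <-].
  case: (unliftP i j) => [k ->|->]; first by apply: AlgGen; exists k.
  by apply: (alg_eq (AlgConst _ 0)) => t; rewrite bi0.
have {IH} step k l : k != l -> a k != 0 -> a l != 0 -> (size (a l) <= size (a k))%N -> False.
  move=> kl ak al lk.
  (* Composing [a l] with c F^m multiplies its leading coefficient by this p-power of [c];
     perfectness of [K] is what allows the leading terms to match. *)
  have [c cE] := proot_exists Kp (size (a l)).-1 (lead_coef (a k) / lead_coef (a l)).
  have c0 : c != 0.
    apply/eqP => c0; move: cE; rewrite c0 (expr0_pX Kp) => /esym/eqP.
    by rewrite mulf_eq0 invr_eq0 !lead_coef_eq0 (negPf ak) (negPf al).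
  pose m := (size (a k) - size (a l))%N.
  pose b' j := if j == l then fun t => b l t + c * b k t ^+ (p ^ m) else b j.
  pose a' j := if j == k then a k - pcomp p c m (a l) else a j.
  have lk' : (l == k) = false by rewrite eq_sym; apply: negbTE.
  have al' : a' l = a l by rewrite /a' lk'.
  have bl t : b l t = b' l t - c * b' k t ^+ (p ^ m).
    by rewrite /b' eqxx (negPf kl) addrK.
  apply: (IH b' _ a' _ l); last 1 first.
  - apply: leq_trans an.
    rewrite (bigD1 k) //= [X in (_ < X)%N](bigD1 k) //=.
    rewrite [X in (_ + X < _)%N](eq_bigr (fun j => size (a j))); last first.
      by move=> j /negPf jk; rewrite /a' jk.
    rewrite ltn_add2r /a' eqxx; apply: size_sub_lead_coef => //.
      by rewrite size_pcomp // subnK.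
    by rewrite lead_coef_pcomp // cE mulrC divfK // lead_coef_eq0.
  - split=> [j|g gg].
      rewrite /b'; case: ifP => _; last exact: gb.1.
      have [blD Rbl] := gb.1 l; have [bkD Rbk] := gb.1 k.
      split; first by move=> s t; rewrite blD bkD (exprD_pX Kp) mulrDr addrACA.
      by apply: AlgAdd => //; apply: alg_scale; exact: alg_exp.
    apply: alg_trans (gb.2 _ gg) => _ [j _ <-].
    have gb' i' : alg (range b') (b' i') by apply: AlgGen; exists i'.
    have [->|jl] := eqVneq j l.
      apply: (alg_eq (alg_sub (gb' l) (alg_scale c (alg_exp (p ^ m) (gb' k))))) => t.
      by rewrite -bl.
    by have := gb' j; rewrite {2}/b' (negPf jl).
  - move=> t; rewrite -[RHS](rel t) (bigD1 k) //= (bigD1 l) 1?eq_sym //=.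
    rewrite [RHS](bigD1 k) //= [X in _ = _ + X](bigD1 l) 1?eq_sym //=.
    rewrite !addrA; congr (_ + _); last first.
      by apply: eq_bigr => j /andP[/negPf jk /negPf jl]; rewrite /a' /b' jk jl.
    rewrite al' /a' /b' !eqxx (negPf kl) /pev psumD psumN -!/(pev _ _ _) pev_comp (pevD Kp).
    by rewrite addrAC -addrA addrK.
  - by rewrite al'.
have ij : i != j0 by rewrite eq_sym.
have [le|lt] := leqP (size (a j0)) (size (a i)).
  exact: (step i j0 ij ai aj le).
exact: (step j0 i ji aj ai (ltnW lt)).
Qed.
End FreeFamilies.

(** * Extension of K[F]-linear maps with values in K *)

Section PartialHomomorphisms.
Variables (K : closedFieldType) (p : nat) (T : Type).
Hypothesis Kp : p \in [pchar K].

(* The graph of a K[F]-linear map to [K] from a K[F]-module of functions. *)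
Record phom (D : (T -> K) -> K -> Prop) : Prop := Phom {
  phom0 : D (fun=> 0) 0;
  phom_lin : forall a f c g d, D f c -> D g d -> D (fun t => a * f t + g t) (a * c + d);
  phom_frob : forall f c, D f c -> D (fun t => f t ^+ p) (c ^+ p);
  phom_fun : forall c, D (fun=> 0) c -> c = 0
}.

Lemma phom_eq (D : (T -> K) -> K -> Prop) f g c d : D f c -> f =1 g -> c = d -> D g d.
Proof. by move=> Df /funext <- <-. Qed.

Section Extension.
Variable D : (T -> K) -> K -> Prop.
Hypothesis Dhom : phom D.

Lemma phom_frobX k f c : D f c -> D (fun t => f t ^+ (p ^ k)) (c ^+ (p ^ k)).
Proof.
move=> Df; elim: k => [|k IH]; first by apply: (phom_eq Df).
by apply: (phom_eq (phom_frob Dhom IH)) => [t|]; rewrite -exprM expnSr.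
Qed.

Lemma phom_add f c g d : D f c -> D g d -> D (fun t => f t + g t) (c + d).
Proof.
move=> Df Dg; apply: (phom_eq (phom_lin Dhom 1 Df Dg)) => [t|]; by rewrite mul1r.
Qed.

Lemma phom_scale a f c : D f c -> D (fun t => a * f t) (a * c).
Proof.
move=> Df; apply: (phom_eq (phom_lin Dhom a Df (phom0 Dhom))) => [t|]; by rewrite addr0.
Qed.

Lemma phom_sum (I : Type) (r : seq I) (f : I -> T -> K) (c : I -> K) :
  (forall i, D (f i) (c i)) -> D (fun t => \sum_(i <- r) f i t) (\sum_(i <- r) c i).
Proof.
move=> Df; elim: r => [|i r IH].
  by apply: (phom_eq (phom0 Dhom)) => [t|]; rewrite big_nil.
by apply: (phom_eq (phom_add (Df i) IH)) => [t|]; rewrite big_cons.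
Qed.

Lemma phom_pev a f c : D f c -> D (fun t => pev p a (f t)) (pev p a c).
Proof.
move=> Df; rewrite /pev /psum; apply: phom_sum => i.
by apply: phom_scale; exact: phom_frobX.
Qed.

Lemma phom_unique f c d : D f c -> D f d -> c = d.
Proof.
move=> Dc Dd; apply/eqP; rewrite -subr_eq0; apply/eqP/(phom_fun Dhom).
apply: (phom_eq (phom_lin Dhom (-1) Dd Dc)) => [t|]; by rewrite mulN1r addrC ?subrr.
Qed.

Variables (g : T -> K) (c : K).

Definition adjoin (f : T -> K) (e : K) :=
  exists a f0 d, [/\ D f0 d, f = fun t => f0 t + pev p a (g t) & e = d + pev p a c].

Lemma adjoin_sub f d : D f d -> adjoin f d.
Proof.
move=> Df; exists 0, f, d; split=> //; last by rewrite /pev psum0 addr0.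
by apply/funext=> t; rewrite /pev psum0 addr0.
Qed.

Lemma adjoin_gen : adjoin g c.
Proof.
exists 1%:P, (fun=> 0), 0; split; first exact: phom0.
  by apply/funext=> t; rewrite pevC mul1r add0r.
by rewrite pevC mul1r add0r.
Qed.

Definition compatible :=
  forall a d, D (fun t => - pev p a (g t)) d -> d + pev p a c = 0.

Lemma adjoin_phom : compatible -> phom adjoin.
Proof.
move=> comp; split.
- exact/adjoin_sub/(phom0 Dhom).
- move=> x _ _ _ _ [a [f [d [Df -> ->]]]] [a' [f' [d' [Df' -> ->]]]].
  exists (x *: a + a'), (fun t => x * f t + f' t), (x * d + d'); split.
  + exact: phom_lin.
  + by apply/funext=> t; rewrite /pev psum_lin; ring.
  + by rewrite /pev psum_lin; ring.
- move=> _ _ [a [f [d [Df -> ->]]]].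
  exists (pfrob p 1 a), (fun t => f t ^+ p), (d ^+ p); split; first exact: phom_frob.
    by apply/funext=> t; rewrite (pev_frob Kp) expn1 -(exprD_pX Kp 1) expn1.
  by rewrite (pev_frob Kp) -{2}(expn1 p) -{1}(expn1 p) (exprD_pX Kp).
- move=> _ [a [f [d [Df /funeqP fE ->]]]]; apply: comp.
  apply: (phom_eq Df) => // t; apply/eqP; rewrite -addr_eq0; apply/eqP.
  exact: (esym (fE t)).
Qed.

Lemma size_pfrob k (a : {poly K}) : a != 0 -> size (pfrob p k a) = (k + size a)%N.
Proof.
move=> a0; have e : size (\poly_(i < size a) (a`_i ^+ (p ^ k))) = size a.
  by rewrite size_poly_eq // -lead_coefE expf_neq0 // lead_coef_eq0.
rewrite /pfrob mulrC size_mulXn; last by rewrite -size_poly_gt0 e size_poly_gt0.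
by rewrite e.
Qed.

Lemma lead_coef_pfrob k (a : {poly K}) : a != 0 ->
  lead_coef (pfrob p k a) = lead_coef a ^+ (p ^ k).
Proof.
move=> a0; rewrite lead_coefE size_pfrob // /pfrob coefXnM.
have sa : (0 < size a)%N by rewrite size_poly_gt0.
have -> : (k + size a).-1 = (k + (size a).-1)%N by rewrite -[in LHS](prednK sa) addnS.
by rewrite ltnNge leq_addr /= addKn coef_poly ltn_predL sa lead_coefE.
Qed.

(* The annihilator of [g] modulo the domain of [D] is a left ideal of K[F],
   generated by any nonzero element of minimal size. *)
Lemma compatible_of_minimal (a0 : {poly K}) d0 : a0 != 0 ->
    D (fun t => - pev p a0 (g t)) d0 -> d0 + pev p a0 c = 0 ->
    (forall a d, a != 0 -> D (fun t => - pev p a (g t)) d -> (size a0 <= size a)%N) ->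
  compatible.
Proof.
move=> a00 D0 e0 amin a; have [n] := ubnP (size a); elim: n a => // n IH a an d Da.
have [aE|a_neq0] := eqVneq a 0.
  move: Da; rewrite aE => Da; rewrite /pev psum0 addr0; apply: (phom_fun Dhom).
  by apply: (phom_eq Da) => // t; rewrite /pev psum0 oppr0.
have le := amin _ _ a_neq0 Da.
pose k := (size a - size a0)%N.
pose x := lead_coef a / lead_coef a0 ^+ (p ^ k).
have l0 : lead_coef a0 ^+ (p ^ k) != 0 by rewrite expf_neq0 // lead_coef_eq0.
have x0 : x != 0 by rewrite mulf_neq0 ?invr_eq0 // lead_coef_eq0.
have := IH (a - x *: pfrob p k a0) _ (d - x * d0 ^+ (p ^ k)).
rewrite /pev psumD psumN psumZ -!/(pev _ _ _) (pev_frob Kp).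
have -> : d - x * d0 ^+ (p ^ k) + (pev p a c - x * pev p a0 c ^+ (p ^ k)) =
    d + pev p a c - x * (d0 + pev p a0 c) ^+ (p ^ k) by rewrite (exprD_pX Kp); ring.
rewrite e0 (expr0_pX Kp) mulr0 subr0; apply.
  rewrite -ltnS (leq_trans _ an) // ltnS; apply: size_sub_lead_coef => //.
    by rewrite size_scale // size_pfrob // subnK.
  by rewrite lead_coefZ lead_coef_pfrob // divfK.
apply: (phom_eq (phom_lin Dhom (- x) (phom_frobX k D0) Da)) => [t|]; last by ring.
have -> : (- pev p a0 (g t)) ^+ (p ^ k) = - pev p a0 (g t) ^+ (p ^ k).
  by apply/eqP; rewrite -addr_eq0 -(exprD_pX Kp) addNr (expr0_pX Kp).
by rewrite psumD psumN psumZ -!/(pev _ _ _) (pev_frob Kp); ring.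
Qed.

End Extension.

Lemma phom_minimal D g : phom D ->
    (forall c, compatible D g c) \/
  exists a0 d0, [/\ a0 != 0, D (fun t => - pev p a0 (g t)) d0 &
    forall a d, a != 0 -> D (fun t => - pev p a (g t)) d -> (size a0 <= size a)%N].
Proof.
move=> Dhom.
pose good s := `[< exists a d, [/\ a != 0, D (fun t => - pev p a (g t)) d & size a = s] >].
have [exg|nog] := pselect (exists s, good s); [right | left].
  have [s /asboolP[a0 [d0 [a00 D0 sE]]] smin] := ex_minnP exg.
  exists a0, d0; split=> // a d a_neq0 Da; rewrite sE; apply: smin.
  by apply/asboolP; exists a, d.
move=> c a d Da; have [aE|a0] := eqVneq a 0.
  move: Da; rewrite aE => Da; rewrite /pev psum0 addr0; apply: (phom_fun Dhom).
  by apply: (phom_eq Da) => // t; rewrite /pev psum0 oppr0.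
by case: nog; exists (size a); apply/asboolP; exists a, d.
Qed.

Lemma pev_poly (a : {poly K}) : exists q : {poly K},
  (forall y, q.[y] = pev p a y) /\ (forall i, q`_(p ^ i) = a`_i).
Proof.
have pgt1 : (1 < p)%N by rewrite prime_gt1 // (pcharf_prime Kp).
exists (\sum_(i < size a) a`_i *: 'X^(p ^ i)); split=> [y|i].
  by rewrite horner_sum; apply: eq_bigr => i _; rewrite hornerZ hornerXn.
rewrite coef_sum; have [ia|ai] := ltnP i (size a).
  rewrite (bigD1 (Ordinal ia)) //= coefZ coefXn eqxx mulr1 big1 ?addr0 // => j ji.
  by move: ji; rewrite -val_eqE coefZ coefXn eqn_exp2l // eq_sym => /negPf /= ->; rewrite mulr0.
rewrite nth_default // big1 // => j _; rewrite coefZ coefXn eqn_exp2l //.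
by rewrite gtn_eqF ?mulr0 // (leq_trans (ltn_ord j)).
Qed.

Lemma pev_surj (a : {poly K}) y : a != 0 -> exists x, pev p a x = y.
Proof.
move=> a0; have [q [qE qc]] := pev_poly a.
have /closed_rootP[x] : size (q - y%:P) != 1%N.
  apply/eqP => /eqP/size_poly1P[c _ qyE].
  case/negP: a0; rewrite -lead_coef_eq0 lead_coefE -qc.
  have -> : q = (c + y)%:P by rewrite polyCD -qyE subrK.
  by rewrite coefC expn_eq0 -[p == 0%N]negbK -lt0n prime_gt0 // (pcharf_prime Kp).
by rewrite /root hornerD hornerN hornerC qE subr_eq0 => /eqP; exists x.
Qed.

(** Write [a] as [a'] composed with F^k, the constant term of [a'] being nonzero. If [a'] is not
    constant, its additive polynomial divided by the variable is nonconstant with nonzero constant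
    term, so it has a nonzero root, whose p^k-th root is a root of [a]. *)
Lemma pev_root (a : {poly K}) : a != 0 ->
  (exists2 x, x != 0 & pev p a x = 0) \/ exists k c, c != 0 /\ a = c *: 'X^k.
Proof.
move=> a0; have [k [a' /implyP/(_ a0)]] := multiplicity_XsubC a 0.
rewrite subr0 /root horner_coef0 => a'0 aE.
have [sa'|sa'] := leqP (size a') 1; [right | left].
  by exists k, a'`_0; split=> //; rewrite aE {1}(size1_polyC sa') mul_polyC.
have [q [qE qc]] := pev_poly a'.
have q0 : root q 0 by rewrite /root qE pev0.
have [h hE] := factor_theorem _ _ q0; rewrite subr0 in hE.
have qsize : (1 < size h)%N.
  have h0 : h != 0 by apply: contraNneq a'0 => h0; rewrite -(qc 0%N) hE h0 mul0r coef0.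
  have pgt1 : (1 < p)%N by rewrite prime_gt1 // (pcharf_prime Kp).
  have a'_neq0 : a' != 0 by apply: contraNneq a'0 => ->; rewrite coef0.
  have : (p ^ (size a').-1 < size q)%N.
    rewrite ltnNge; apply/negP => /(nth_default 0); rewrite qc -lead_coefE => /eqP.
    by rewrite lead_coef_eq0 (negPf a'_neq0).
  rewrite hE size_mulX // ltnS; apply: leq_trans.
  by rewrite -{1}(expn0 p) ltn_exp2l // -ltnS prednK // ltnW.
have /closed_rootP[x hx] : size h != 1%N by rewrite neq_ltn qsize orbT.
have x0 : x != 0.
  apply: contraNneq a'0 => x0; move: hx; rewrite x0 /root horner_coef0.
  by rewrite -(qc 0%N) expn0 hE coefMX.
exists (proot Kp k x); first by apply: contra_neq x0 => h0; rewrite -(prootK Kp k x) h0 (expr0_pX Kp).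
rewrite aE /pev mulrC psumXnM.
have -> : psum (fun i => proot Kp k x ^+ (p ^ (k + i))) a' = pev p a' x.
  by apply: eq_bigr => i _; rewrite expnD exprM prootK.
by rewrite -qE hE hornerM (eqP hx) mul0r.
Qed.

(** [K] is divisible over K[F], as nonzero p-polynomials are onto. So the single condition on [c],
    imposed by a generator of the annihilator of [g] modulo the domain, can be solved. *)
Lemma phom_extend D g : phom D -> exists D' c,
  [/\ phom D', forall f d, D f d -> D' f d & D' g c].
Proof.
move=> Dhom; have [c comp] : exists c, compatible D g c.
  have [all|[a0 [d0 [a00 D0 amin]]]] := phom_minimal g Dhom; first by exists 0.
  have [c cE] := pev_surj (- d0) a00.
  exists c; apply: (compatible_of_minimal Dhom a00 D0) => //.
  by rewrite cE subrr.
exists (adjoin D g c), c; split; [exact: adjoin_phom | exact: adjoin_sub | exact: adjoin_gen].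
Qed.

Lemma phom_extend_family D r (b : 'I_r -> T -> K) : phom D -> exists D' c,
  [/\ phom D', forall f d, D f d -> D' f d & forall i, D' (b i) (c i)].
Proof.
move=> Dhom.
have [D' [D'hom DD' D'b]] : exists D', [/\ phom D', forall f d, D f d -> D' f d &
    forall i, i \in enum 'I_r -> exists c, D' (b i) c].
  elim: (enum 'I_r) => [|i s [D1 [hom1 DD1 D1b]]]; first by exists D.
  have [D2 [c [hom2 D12 D2b]]] := phom_extend (b i) hom1.
  exists D2; split=> // [f d Df|j]; first exact/D12/DD1.
  rewrite inE => /orP[/eqP ->|/D1b[d Dd]]; first by exists c.
  by exists d; exact: D12.
have cP i : exists c, D' (b i) c by apply: D'b; rewrite mem_enum.
exists D', (fun i => sval (cid (cP i))); split=> // i; exact: (svalP (cid (cP i))).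
Qed.

(* An additive Nullstellensatz: a root of the annihilator of [a] modulo K[F]m
   extends to a K[F]-linear map killing [m], hence to a point of [T]. *)
Lemma additive_nullstellensatz d r (m : 'I_d -> T -> K) (b : 'I_r -> T -> K) (a : T -> K) :
    let span f := exists u : 'I_r -> {poly K}, forall t, f t = \sum_i pev p (u i) (b i t) in
    (forall c : 'I_r -> K, exists t, forall i, b i t = c i) ->
    (forall j, span (m j)) -> span a -> (forall t, (forall j, m j t = 0) -> a t = 0) ->
  exists N (u : 'I_d -> {poly K}), forall t, a t ^+ (p ^ N) = \sum_j pev p (u j) (m j t).
Proof.
move=> span bsurj mspan aspan ker.
pose D0 (f : T -> K) (e : K) := e = 0 /\
  exists u : 'I_d -> {poly K}, forall t, f t = \sum_j pev p (u j) (m j t).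
have D0hom : phom D0.
  split.
  - by split=> //; exists (fun=> 0) => t; rewrite big1 // => j _; rewrite /pev psum0.
  - move=> x f _ g _ [-> [u uE]] [-> [v vE]]; split; first by rewrite mulr0 addr0.
    exists (fun j => x *: u j + v j) => t; rewrite uE vE mulr_sumr -big_split.
    by apply: eq_bigr => j _; rewrite /pev psum_lin.
  - move=> f _ [-> [u uE]]; split; first by rewrite -[X in _ ^+ X](expn1 p) (expr0_pX Kp).
    exists (fun j => pfrob p 1 (u j)) => t; rewrite uE -[X in _ ^+ X](expn1 p) (expr_sum_pX Kp).
    by apply: eq_bigr => j _; rewrite (pev_frob Kp).
  - by move=> c [].
(* [D0] is the zero map on the span of [m]. Extended with the value [c] at [a] and then to all of
   [b], it is evaluation at some point, where [m] vanishes and [a] does not. *)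
have nonzero c : c != 0 -> compatible D0 a c -> False.
  move=> c0 comp.
  have [D2 [v [D2hom D12 D2b]]] := phom_extend_family b (adjoin_phom D0hom comp).
  have [t tv] := bsurj v.
  have D2E f e : span f -> D2 f e -> f t = e.
    move=> [u uE] Df; apply: (phom_unique D2hom _ Df).
    apply: (phom_eq (phom_sum D2hom (index_enum _) (fun i => phom_pev D2hom (u i) (D2b i)))).
      by move=> s; rewrite uE.
    by rewrite uE; apply: eq_bigr => i _; rewrite tv.
  have ac : a t = c by apply: D2E => //; exact/D12/(adjoin_gen D0hom).
  case/eqP: c0; rewrite -ac.
  apply: ker => j; apply: D2E => //; apply/D12/adjoin_sub; split=> //.
  exists (fun i => if i == j then 1%:P else 0) => s; rewrite (bigD1 j) //= eqxx pevC mul1r.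
  by rewrite big1 ?addr0 // => i /negPf ->; rewrite /pev psum0.
(* Without annihilator any value is allowed, say 1; an annihilator with a nonzero root allows that
   root. What remains is c F^N, and its relation is the conclusion. *)
have [all|[a0 [d0 [a00 D00 amin]]]] := phom_minimal a D0hom.
  by case: (nonzero 1 (oner_neq0 _) (all 1)).
have [d00 [u uE]] := D00.
have [[x x0 ax]|[N [c [c0 aE]]]] := pev_root a00.
  case: (nonzero x x0); apply: (compatible_of_minimal D0hom a00 D00) => //.
  by rewrite ax d00 addr0.
exists N, (fun j => (- c^-1) *: u j) => t.
transitivity (- c^-1 * (- pev p a0 (a t))).
  by rewrite aE /pev psumZ psumXn mulrNN mulKf.
by rewrite uE mulr_sumr; apply: eq_bigr => j _; rewrite /pev psumZ.
Qed.

End PartialHomomorphisms.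

(** * Irreducible actions of a connected group *)

Section SimpleModule.
Variables (K : closedFieldType) (p : nat) (T : zmodType).
Hypothesis Kp : p \in [pchar K].
Hypothesis Tp : forall t : T, t *+ p = 0.
Variables (N : nat) (x : T -> 'cV[K]_N).
Let xcoord (i : 'I_N) : T -> K := fun t => x t i 0.
Local Notation R := (alg (range xcoord)).
Local Notation A := (addR (range xcoord)).
Hypothesis x_inj : injective x.
Hypothesis x_shift : forall v, exists M : 'M_N, forall t, x (t + v) = M *m x t.
Hypothesis x_deg : forall i, exists m, dle m (xcoord i).
Hypothesis x_closed : forall y : 'cV[K]_N,
  (forall F, alg (range (@coord K 'I_N)) F ->
     (forall t, F (fun i => x t i 0) = 0) -> F (fun i => y i 0) = 0) ->
  exists t, x t = y.
Variables (G : Type) (op : G -> G -> G) (e : G) (act : G -> T -> T).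
Hypothesis actD : forall g s t, act g (s + t) = act g s + act g t.
Hypothesis actM : forall g h t, act (op g h) t = act g (act h t).
Hypothesis act1 : forall t, act e t = t.
Hypothesis x_act : forall g, exists M : 'M_N, forall t, x (act g t) = M *m x t.
(** Only the functions on [G] generated by coordinates along orbits; the embedding of [G] in
    matrices does not appear in this section. *)
Definition regG := alg [set phi : G -> K | exists i t, phi = fun g => x (act g t) i 0].
Hypothesis conn : forall phi (q : {poly K}), regG phi -> q != 0 ->
  (forall g, root q (phi g)) -> forall g, phi g = phi e.
Hypothesis irr : forall d (m : 'I_d -> T -> K), (forall j, A (m j)) ->
  (forall g t, (forall j, m j t = 0) -> forall j, m j (act g t) = 0) ->
  (forall t, (forall j, m j t = 0) -> t = 0) \/ (forall t j, m j t = 0).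
Hypothesis Tinf : forall (f : T -> K) (q : {poly K}),
  injective f -> q != 0 -> (forall t, root q (f t)) -> False.

Lemma regG_eval f t : R f -> regG (fun g => f (act g t)).
Proof.
apply: (@alg_comp _ _ _ _ _ (fun g => act g t)) => _ [i _ <-].
by apply: AlgGen; exists i, t.
Qed.

Lemma R_act g f : R f -> R (fun t => f (act g t)).
Proof.
apply: (@alg_comp _ _ _ _ _ (act g)) => _ [i _ <-].
have [M ME] := x_act g.
apply: (@alg_eq _ _ _ (fun t => \sum_j M i j * xcoord j t)); last first.
  by move=> t; rewrite /xcoord /= ME mxE.
by apply: alg_sum => j _; apply: alg_scale; apply: AlgGen; exists j.
Qed.

Lemma A_act g f : A f -> A (fun t => f (act g t)).
Proof. by move=> [fD Rf]; split; [move=> s t; rewrite actD fD | exact: R_act]. Qed.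

Lemma act0 g : act g 0 = 0.
Proof. by apply: (addrI (act g 0)); rewrite -actD !addr0. Qed.

Lemma additive_fun_inj (f : T -> K) : additive_fun f -> (forall t, f t = 0 -> t = 0) -> injective f.
Proof.
move=> fD f0 s t fst; apply/eqP; rewrite -subr_eq0; apply/eqP/f0.
by rewrite fD additive_funN // fst subrr.
Qed.

(** Invariance makes the kernel of [f] stable. A trivial kernel would embed [T] into the finitely
    many roots of a polynomial, against [Tinf]. *)
Lemma A_torsion_free f : A f -> forall a : {poly K}, a != 0 ->
  (forall t, pev p a (f t) = 0) -> forall t, f t = 0.
Proof.
move=> Af a a0 fa; have [fD Rf] := Af; have [q [qE qc]] := pev_poly Kp a.
have q0 : q != 0.
  apply: contraNneq a0 => q0; apply/eqP/polyP => i; by rewrite -qc q0 !coef0.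
have rootq t : root q (f t) by rewrite /root qE fa.
have inv g t : f (act g t) = f t.
  by rewrite -[in RHS](act1 t); apply: (conn (regG_eval t Rf) q0 (fun g => rootq _)).
have [//|g t h j|inj|f0] := @irr 1 (fun=> f); first by rewrite inv; exact: (h j).
  by case: (Tinf (additive_fun_inj fD (fun t ft => inj t (fun=> ft))) q0 rootq).
by move=> t; exact: (f0 t ord0).
Qed.

Lemma R_additive f : R f -> alg A f.
Proof.
apply: (alg_generated_by_additive Kp Tp).
- move=> v _ [i _ <-]; have [M ME] := x_shift v.
  apply: (@alg_eq _ _ _ (fun t => \sum_j M i j * xcoord j t)); last first.
    by move=> t; rewrite /xcoord /= ME mxE.
  by apply: alg_sum => j _; apply: alg_scale; apply: AlgGen; exists j.
- move=> _ [i _ <-]; exists N, xcoord => v; have [M ME] := x_shift v.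
  by exists (M i); apply/funext=> t; rewrite /xcoord ME mxE.
- by move=> _ [i _ <-]; exact: x_deg.
Qed.

Lemma A_generates : exists r (b : 'I_r -> T -> K), generates (range xcoord) b.
Proof.
have [r [b [Ab bgen]]] : exists r (b : 'I_r -> T -> K), (forall i, A (b i)) /\
    forall i, i \in enum 'I_N -> alg (range b) (xcoord i).
  elim: (enum 'I_N) => [|i s [r1 [b1 [Ab1 gen1]]]].
    by exists 0%N, (fun=> fun=> 0); split=> // -[].
  have [|r2 [b2 [Ab2 gen2]]] := @alg_finite _ _ A (xcoord i).
    by apply: R_additive; apply: AlgGen; exists i.
  have [r [b [Ab h1 h2]]] := alg_common_family Ab1 Ab2.
  exists r, b; split=> // j; rewrite inE => /orP[/eqP ->|/gen1]; [exact: h2 | exact: h1].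
by exists r, b; split=> // _ [i _ <-]; apply: bgen; rewrite mem_enum.
Qed.

Lemma pfree_surj r (b : 'I_r -> T -> K) : generates (range xcoord) b -> pfree p b ->
  forall c : 'I_r -> K, exists t, forall i, b i t = c i.
Proof.
move=> [Ab bgen] bfree c.
have bD i : additive_fun (b i) by case: (Ab i).
have FP i : exists F, alg (range (@coord K 'I_r)) F /\ forall t, xcoord i t = F (b^~ t).
  have [|F AF FE] := @alg_factor _ _ _ b (xcoord i); first by apply: bgen; exists i.
  by exists F; split=> // t; rewrite FE.
pose F i := sval (cid (FP i)).
have [FA FE] : (forall i, alg (range (@coord K 'I_r)) (F i)) /\ forall i t, xcoord i t = F i (b^~ t).
  by split=> i; have [] := svalP (cid (FP i)).
have subst H : alg (range (@coord K 'I_N)) H ->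
    alg (range (@coord K 'I_r)) (fun y => H (fun i => F i y)).
  by apply: alg_subst.
have [|t tE] := x_closed (y := \col_i F i c).
  move=> H AH H0; under eq_fun do rewrite mxE.
  apply: (pfree_dense Kp bD bfree (subst _ AH)) => t.
  by rewrite -[RHS](H0 t); congr H; apply/funext=> i; rewrite -FE.
exists t => i; have [_ /alg_factor[H AH HE]] := Ab i.
have bE s : b i s = H (fun j => F j (b^~ s)).
  by rewrite HE; congr H; apply/funext=> j; exact: FE.
(* Each [b i] is a polynomial [H] in the coordinates [x], themselves polynomials in [b]. The
   identity [H (F y) = y i] holds on the dense image of [T], hence at [c]. *)
have := pfree_dense Kp bD bfree (F := fun y => H (fun i => F i y) - coord i y) _ _ c.
have -> : b i t = H (fun j => F j c).
  by rewrite HE; congr H; apply/funext=> j; rewrite /xcoord tE mxE.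
move=> h; apply/eqP; rewrite -subr_eq0; apply/eqP; apply: h.
  by apply: alg_sub; [exact: subst | apply: AlgGen; exists i].
by move=> s; rewrite -bE subrr.
Qed.

(** Since [b] is onto, additivity of [f] on [T] passes to the polynomial expressing it on affine
    space. *)
Lemma A_span r (b : 'I_r -> T -> K) : generates (range xcoord) b -> pfree p b ->
  forall f, A f -> exists u : 'I_r -> {poly K}, forall t, f t = \sum_i pev p (u i) (b i t).
Proof.
move=> bgen bfree f [fD Rf].
have [F AF FE] : exists2 F, alg (range (@coord K 'I_r)) F & f = fun t => F (b^~ t).
  by apply: alg_factor; apply: alg_trans Rf => g; exact: bgen.2.
have surj := pfree_surj bgen bfree.
have [|u uE] := additive_polyfun Kp AF; last by exists u => t; rewrite FE uE.
move=> y z; have [s sy] := surj y; have [t tz] := surj z.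
have -> : y = b^~ s by apply/funext=> i; rewrite sy.
have -> : z = b^~ t by apply/funext=> i; rewrite tz.
have := fD s t; rewrite FE /= => <-; congr F; apply/funext=> i.
by rewrite addrfctE (bgen.1 i).1.
Qed.

Section Families.

(** A basis of a stable d-dimensional space of additive functions, arranged as one column-valued
    map. *)
Record gfam d (m : T -> 'cV[K]_d) : Prop := Gfam {
  gfam_add : forall j, A (fun t => m t j 0);
  gfam_indep : forall w : 'rV_d, (forall t, w *m m t = 0) -> w = 0;
  gfam_stable : forall g, exists rho : 'M_d, forall t, m (act g t) = rho *m m t
}.

Lemma A_lin d (m : T -> 'cV[K]_d) k (U : 'M_(k, d)) : (forall j, A (fun t => m t j 0)) ->
  forall j, A (fun t => (U *m m t) j 0).
Proof.
move=> Am j; have -> : (fun t => (U *m m t) j 0) = fun t => \sum_i U j i * m t i 0.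
  by apply/funext=> t; rewrite mxE.
split; last by apply: alg_sum => i _; apply: alg_scale; case: (Am i).
move=> s t; rewrite -big_split; apply: eq_bigr => i _.
by have [fD _] := Am i; rewrite fD mulrDr.
Qed.

Lemma gfamD d (m : T -> 'cV[K]_d) : (forall j, A (fun t => m t j 0)) ->
  forall s t, m (s + t) = m s + m t.
Proof. by move=> Am s t; apply/colP=> j; have [fD _] := Am j; rewrite fD mxE. Qed.

(** A spanning family is cut down to a basis: [Z] collects its linear relations, and a basis [U] of
    a complement of [Z] gives independent functions spanning the same space. *)
Lemma gfam_of_stable d (m : T -> 'cV[K]_d) t0 : (forall j, A (fun t => m t j 0)) ->
    (forall g, exists rho : 'M_d, forall t, m (act g t) = rho *m m t) -> m t0 != 0 ->
  exists d' (m' : T -> 'cV[K]_d'), (0 < d')%N /\ gfam m'.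
Proof.
move=> Am mst mt0.
have [||Z ZP] := @subspace_basis K d (fun w => forall t, w *m m t = 0).
- by move=> t; rewrite mul0mx.
- by move=> a u v hu hv t; rewrite mulmxDl -scalemxAl hu hv scaler0 addr0.
have ZM t : Z *m m t = 0.
  by apply/row_matrixP=> i; rewrite row_mul row0; exact: (iffRL (ZP (row i Z)) (row_sub i Z) t).
have [k [U [Ufree UZ]]] : exists k (U : 'M_(k, d)), row_free U /\ (U :=: Z^C)%MS.
  by exists _, (row_base (Z^C)%MS); split; [exact: row_base_free | exact: eq_row_base].
have /submxP[C CE] : (Z^C <= U)%MS by rewrite UZ.
have /sub_addsmxP[[D E] /= DE] : (1%:M <= Z + Z^C)%MS.
  by rewrite submx_full // addsmx_compl_full.
have mE t : m t = E *m C *m (U *m m t).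
  by rewrite -[LHS]mul1mx DE mulmxDl -(mulmxA D) ZM mulmx0 add0r CE !mulmxA.
exists _, (fun t => U *m m t); split.
  rewrite lt0n; apply/eqP => k0; case/eqP: mt0; rewrite mE.
  by move: (E *m C) (U *m m t0); rewrite k0 => X Y; rewrite [Y]flatmx0 mulmx0.
split; first exact: A_lin.
- move=> w wU; have h : (w *m U <= Z)%MS by apply/ZP => t; rewrite -mulmxA wU.
  have : (w *m U <= Z :&: Z^C)%MS by rewrite sub_capmx h -UZ submxMl.
  rewrite capmx_compl submx0 => /eqP wU0.
  by apply: (row_free_inj Ufree); rewrite wU0 mul0mx.
- move=> g; have [rho rhoE] := mst g; exists (U *m rho *m E *m C) => t.
  by rewrite rhoE {1}mE !mulmxA.
Qed.

(** The additive functions among the [w *m (x - x 0)] form a stable space. It is nonzero: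
    differences of a nonconstant coordinate stay combinations of coordinates, and one takes them as
    long as a nonconstant difference exists. The last function is additive up to a constant. *)
Lemma gfam_exists : exists d (m : T -> 'cV[K]_d), (0 < d)%N /\ gfam m.
Proof.
pose P (w : 'rV[K]_N) := additive_fun (fun t => (w *m (x t - x 0)) 0 0).
have [||U UP] := @subspace_basis K N P.
- by move=> s t; rewrite !mul0mx !mxE addr0.
- move=> a u v hu hv s t; rewrite !mulmxDl -!scalemxAl.
  by rewrite [LHS]mxE [X in X + _]mxE hu [X in _ + X]hv !mxE; ring.
have PU i : P (row i U) by apply/UP; exact: row_sub.
have [w [Pw [t0 wt0]]] : exists w, P w /\ exists t, (w *m (x t - x 0)) 0 0 != 0.
  have [t1 t10] : exists t1 : T, x t1 != x 0.
    apply: contrapT => h; have T0 (t : T) : t = 0.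
      by apply: x_inj; apply: contrapT => xt; apply: h; exists t; apply/eqP.
    apply: (Tinf (f := fun=> 0) (q := 'X)); rewrite ?polyX_eq0 //.
      by move=> s t _; rewrite (T0 s) (T0 t).
    by move=> t; rewrite rootX.
  have [i xi] : exists i, x t1 i 0 != x 0 i 0.
    apply: contrapT => h; case/eqP: t10; apply/colP => i.
    by apply: contrapT => xi; apply: h; exists i; apply/eqP.
  have [m dm] := x_deg i.
  have [w [dw nw]] : exists w : 'rV_N, dle m (fun t => (w *m x t) 0 0) /\
      exists t, (w *m x t) 0 0 != (w *m x 0) 0 0.
    exists (delta_mx 0 i); split; last by exists t1; rewrite -!rowE !mxE.
    by rewrite (_ : (fun _ => _) = xcoord i) //; apply/funext=> t; rewrite -rowE mxE.
  have spA := additive_space_full K T.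
  elim: m w dw nw {dm} => [|m IH] w dw [t wt].
    by move: wt; rewrite [X in X != _](dw t) eqxx.
  have [[v [s wvs]]|cst] := pselect (exists v s, delta v (fun t => (w *m x t) 0 0) s !=
      delta v (fun t => (w *m x t) 0 0) 0).
    have [M ME] := x_shift v.
    have dE s' : (w *m (M - 1%:M) *m x s') 0 0 = delta v (fun t => (w *m x t) 0 0) s'.
      by rewrite /delta ME mulmxBr mulmx1 mulmxBl -mulmxA !mxE.
    apply: (IH (w *m (M - 1%:M))); last by exists s; rewrite !dE.
    rewrite (_ : (fun _ => _) = delta v (fun t => (w *m x t) 0 0)); last exact/funext.
    exact: symb_in_delta.
  exists w; split; last by exists t; rewrite mulmxBr mxE [X in _ + X]mxE subr_eq0.
  have c v s : delta v (fun t => (w *m x t) 0 0) s = delta v (fun t => (w *m x t) 0 0) 0.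
    by apply: contrapT => h; apply: cst; exists v, s; apply/eqP.
  have subE s : (w *m (x s - x 0)) 0 0 = (w *m x s) 0 0 - (w *m x 0) 0 0.
    by rewrite mulmxBr mxE [X in _ + X]mxE.
  move=> s s'; rewrite !subE.
  have := c s' s; rewrite /delta add0r => /eqP; rewrite subr_eq => /eqP h.
  rewrite h; ring.
apply: (@gfam_of_stable _ (fun t => U *m (x t - x 0)) t0).
- move=> j; split.
    by move=> s t; have := PU j s t; rewrite -!row_mul ![row _ _ 0 0]mxE.
  rewrite (_ : (fun _ => _) = fun t => \sum_i U j i * (xcoord i t - xcoord i 0)); last first.
    by apply/funext=> t; rewrite mxE; apply: eq_bigr => i _; rewrite !mxE.
  apply: alg_sum => i _; apply: alg_scale; apply: alg_sub; last exact: AlgConst.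
  by apply: AlgGen; exists i.
- move=> g; have [M ME] := x_act g.
  have /submxP[C CE] : (U *m M <= U)%MS.
    apply/row_subP => i; apply/UP => s t; rewrite row_mul -!mulmxA !mulmxBr -!ME.
    by have := PU i (act g s) (act g t); rewrite -actD !mulmxBr !act0.
  by exists C => t; rewrite ME -{1}[0](act0 g) ME -mulmxBr !mulmxA CE.
- have /UP/submxP[y wE] := Pw; apply: contra_neq wt0 => h.
  by rewrite wE -mulmxA h mulmx0 mxE.
Qed.

(** At points of largest rank, a row vector killing all the values but not [m] would supply one more
    point. With full rank, [rho g] can be solved for from the values of [m] at [act g (tau j)], so
    its trace is regular. *)
Lemma indep_points d (m : T -> 'cV[K]_d) :
    (forall w : 'rV_d, (forall t, w *m m t = 0) -> w = 0) ->
  exists k (tau : 'I_k -> T), row_free (\matrix_(i < d, j < k) m (tau j) i 0).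
Proof.
move=> indep.
pose Mt k (tau : 'I_k -> T) := \matrix_(i < d, j < k) m (tau j) i 0.
pose good r := `[< exists k (tau : 'I_k -> T), \rank (Mt k tau) = r >].
have exg : exists r, good r by exists (\rank (Mt 1%N (fun=> 0))); apply/asboolP; exists 1%N, (fun=> 0).
have gle r : good r -> (r <= d)%N by move=> /asboolP[k [tau <-]]; exact: rank_leq_row.
have [r /asboolP[k [tau rE]] rmax] := ex_maxnP exg gle.
exists k, tau; apply: contraT => nfree.
have [w wM w0] : exists2 w : 'rV_d, w *m Mt k tau = 0 & w != 0.
  have : kermx (Mt k tau) != 0 by rewrite kermx_eq0.
  move/rowV0Pn => [w /sub_kermxP wM w0]; by exists w.
have [t wt] : exists t, w *m m t != 0.
  apply: contrapT => h; case/eqP: w0; apply: indep => t.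
  by apply: contrapT => wt; apply: h; exists t; apply/eqP.
pose tau' (j : 'I_(k + 1)) := if fintype.split j is inl i then tau i else t.
have M'E : Mt _ tau' = row_mx (Mt k tau) (m t).
  apply/matrixP => i j; rewrite !mxE /tau'; case: splitP => j' _; rewrite ?mxE //.
  by rewrite (ord1 j').
have : good (\rank (Mt _ tau')) by apply/asboolP; exists (k + 1)%N, tau'.
move/rmax; rewrite -rE leqNgt => /negP[].
have kle : (kermx (Mt _ tau') <= kermx (Mt k tau))%MS.
  apply/sub_kermxP; have := mulmx_ker (Mt _ tau'); rewrite {2}M'E mul_mx_row => /eqP.
  by rewrite row_mx_eq0 => /andP[/eqP].
have : (kermx (Mt _ tau') < kermx (Mt k tau))%MS.
  rewrite /ltmx kle /=; apply/negP => h.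
  have : (w <= kermx (Mt _ tau'))%MS by apply: submx_trans h; apply/sub_kermxP.
  move/sub_kermxP; rewrite M'E mul_mx_row wM => /eqP; rewrite row_mx_eq0.
  by rewrite (negPf wt) andbF.
move/rank_ltmx; rewrite !mxrank_ker => lt; rewrite ltnNge; apply/negP => le.
by move: lt; rewrite ltnNge leq_sub2l.
Qed.

Section Minimal.
Variables (d : nat) (m : T -> 'cV[K]_d).
Hypotheses (d0 : (0 < d)%N) (gm : gfam m).
Hypothesis dmin : forall d' (m' : T -> 'cV[K]_d'), (0 < d')%N -> gfam m' -> (d <= d')%N.

(** A basis of the subspace [P] applied to [m] is again a stable family, so by minimality it has [d]
    members. *)
Lemma gfam_irr (P : 'rV[K]_d -> Prop) : P 0 ->
    (forall a u v, P u -> P v -> P (a *: u + v)) ->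
    (forall g (rho : 'M_d) w, (forall t, m (act g t) = rho *m m t) -> P w -> P (w *m rho)) ->
  (exists2 w, P w & w != 0) -> forall w, P w.
Proof.
move=> P0 Plin Pst [w0 Pw0 w00].
have [U UP] := subspace_basis P0 Plin.
have [r [B [Bfree BU]]] : exists r (B : 'M_(r, d)), row_free B /\ (B :=: U)%MS.
  by exists _, (row_base U); split; [exact: row_base_free | exact: eq_row_base].
have rU : \rank U = r by rewrite -BU; apply/eqP.
have r0 : (0 < r)%N.
  rewrite -rU lt0n mxrank_eq0; apply: contraNneq w00 => U0.
  by rewrite -submx0 -U0; apply/UP.
suff dr : (d <= r)%N by move=> w; apply/UP; rewrite submx_full // -col_leq_rank rU.
apply: (dmin (m' := fun t => B *m m t)) => //; split.
- apply: A_lin; exact: gfam_add gm.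
- move=> w wB; apply: (row_free_inj Bfree); rewrite mul0mx.
  by apply: (gfam_indep gm) => t; rewrite -mulmxA wB.
- move=> g; have [rho rhoE] := gfam_stable gm g.
  have /submxP[C CE] : (B *m rho <= B)%MS.
    apply/row_subP => i; rewrite BU row_mul; apply/UP; apply: (Pst g) => //.
    by apply/UP; rewrite -BU row_sub.
  by exists C => t; rewrite rhoE !mulmxA CE.
Qed.

Definition rho g := sval (cid (gfam_stable gm g)).

Lemma rhoE g t : m (act g t) = rho g *m m t.
Proof. exact: (svalP (cid (gfam_stable gm g))). Qed.

Lemma mx_ext k (X Y : 'M[K]_(k, d)) : (forall t, X *m m t = Y *m m t) -> X = Y.
Proof.
move=> XY; apply/eqP; rewrite -subr_eq0; apply/eqP/row_matrixP => i; rewrite row0.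
by apply: (gfam_indep gm) => t; rewrite -row_mul mulmxBl XY subrr row0.
Qed.

Lemma rhoM g h : rho (op g h) = rho g *m rho h.
Proof. by apply: mx_ext => t; rewrite -mulmxA -!rhoE actM. Qed.

Lemma rho1 : rho e = 1%:M.
Proof. by apply: mx_ext => t; rewrite -rhoE act1 mul1mx. Qed.

Lemma regG_trace : regG (fun g => \tr (rho g)).
Proof.
have [k [tau free]] := indep_points (gfam_indep gm).
set M := \matrix_(i, j) _ in free.
pose Mg g := \matrix_(i < d, j < k) m (act g (tau j)) i 0.
have rE g : rho g = Mg g *m pinvmx M.
  have -> : Mg g = rho g *m M.
    apply/matrixP=> i j; rewrite !mxE rhoE mxE; apply: eq_bigr => l _; by rewrite mxE.
  by rewrite -mulmxA mulmxVp // mulmx1.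
apply: (@alg_eq _ _ _ (fun g => \sum_i \sum_j m (act g (tau j)) i 0 * pinvmx M j i)).
  apply: alg_sum => i _; apply: alg_sum => j _; apply: AlgMul; last exact: AlgConst.
  by have [_ Rm] := gfam_add gm i; exact: (regG_eval (tau j) Rm).
move=> g; rewrite rE; apply: eq_bigr => i _; rewrite mxE; apply: eq_bigr => j _.
by rewrite [Mg g i j]mxE.
Qed.

Lemma rho_irr : irreducible_mxset (range rho).
Proof.
move=> U Ust; have [U0|U0] := eqVneq U 0; [by left | right].
have all : forall w : 'rV_d, (w <= U)%MS.
  apply: gfam_irr; first exact: sub0mx.
  - by move=> a u v hu hv; rewrite addmx_sub // scalemx_sub.
  - move=> g r w rE wU; have -> : r = rho g by apply: mx_ext => t; rewrite -rhoE rE.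
    by apply: submx_trans (submxMr _ wU) _; apply: Ust; exists g.
  - by have /rowV0Pn[w wU w0] := U0; exists w.
by rewrite -sub1mx; apply/row_subP => i; exact: all.
Qed.

Definition Fr k a b (X : 'M[K]_(a, b)) : 'M_(a, b) := map_mx (fun z => z ^+ (p ^ k)) X.

Lemma FrM k a b c (X : 'M[K]_(a, b)) (Y : 'M_(b, c)) : Fr k (X *m Y) = Fr k X *m Fr k Y.
Proof.
apply/matrixP => i j; rewrite !mxE (expr_sum_pX Kp); apply: eq_bigr => l _.
by rewrite exprMn !mxE.
Qed.

Lemma Fr_inj k a b (X Y : 'M[K]_(a, b)) : Fr k X = Fr k Y -> X = Y.
Proof.
move=> /matrixP XY; apply/matrixP => i j; apply: (expr_pX_inj Kp (k := k)).
by have := XY i j; rewrite !mxE.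
Qed.

Lemma Fr_id a b (X : 'M[K]_(a, b)) : Fr 0 X = X.
Proof. by apply/matrixP => i j; rewrite mxE expn0 expr1. Qed.

Lemma Fr0 k a b : Fr k (0 : 'M[K]_(a, b)) = 0.
Proof. by apply/matrixP => i j; rewrite !mxE (expr0_pX Kp). Qed.

Lemma Fr_sum k a b (I : Type) (s : seq I) (F : I -> 'M[K]_(a, b)) :
  Fr k (\sum_(i <- s) F i) = \sum_(i <- s) Fr k (F i).
Proof.
apply: (big_morph (@Fr k a b)) => [X Y|]; last exact: Fr0.
by apply/matrixP => i j; rewrite !mxE (exprD_pX Kp).
Qed.

Definition Froot a b (X : 'M[K]_(a, b)) : 'M_(a, b) := map_mx (proot Kp 1) X.

Lemma FrootK a b (X : 'M[K]_(a, b)) : Fr 1 (Froot X) = X.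
Proof. by apply/matrixP => i j; rewrite !mxE prootK. Qed.

Lemma Fr_Fr k a b (X : 'M[K]_(a, b)) : Fr 1 (Fr k X) = Fr k.+1 X.
Proof. by apply/matrixP => i j; rewrite !mxE -exprM -expnD addn1. Qed.

Lemma tr_Fr k (X : 'M[K]_d) : \tr (Fr k X) = \tr X ^+ (p ^ k).
Proof. by rewrite /mxtrace (expr_sum_pX Kp); apply: eq_bigr => i _; rewrite mxE. Qed.

(* A shortest relation over K[F] between the coordinates of [m] intertwines [rho] with
   its Frobenius twist, so that [\tr (rho g)] lies in a finite field. Connectedness makes
   this trace constant, whence a nonzero invariant in A, so [d = 1] and A has torsion. *)
Lemma gfam_free n (a : nat -> 'rV[K]_d) :
  (forall t, \sum_(k < n) a k *m Fr k (m t) = 0) -> forall k, (k < n)%N -> a k = 0.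
Proof.
elim: n a => // n IH a rel.
pose Rel (a : nat -> 'rV[K]_d) := forall t, \sum_(k < n.+1) a k *m Fr k (m t) = 0.
(* A relation without constant coefficient is F applied to a shorter one, whose coefficients are the
   p-th roots. *)
have Rel0 b : Rel b -> b 0%N = 0 -> forall k, (k < n.+1)%N -> b k = 0.
  move=> Rb b0; have h : forall k, (k < n)%N -> Froot (b k.+1) = 0.
    apply: (IH (fun k => Froot (b k.+1))) => t.
    apply: (@Fr_inj 1); rewrite Fr0 Fr_sum -[RHS](Rb t) big_ord_recl b0 mul0mx add0r.
    by apply: eq_bigr => k _; rewrite FrM FrootK Fr_Fr.
  by case=> // k kn; rewrite -[b k.+1]FrootK h // Fr0.
have [a0|a0] := eqVneq (a 0%N) 0; first exact: Rel0.
exfalso.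
have n0 : (0 < n)%N.
  rewrite lt0n; apply: contra_neq a0 => n0; apply: (gfam_indep gm) => t.
  by have := rel t; rewrite n0 big_ord1 Fr_id.
(* The constant coefficients of relations of this length form a stable subspace, since a relation
   taken at [act g t] is again a relation. It contains [a 0], so it is everything, and [B] below
   collects relations with [B 0 = 1]. *)
have all : forall w, exists2 b, Rel b & b 0%N = w.
  apply: (@gfam_irr (fun w => exists2 b, Rel b & b 0%N = w)).
  - by exists (fun=> 0) => // t; rewrite big1 // => k _; rewrite mul0mx.
  - move=> c _ _ [b Rb <-] [b' Rb' <-]; exists (fun k => c *: b k + b' k) => // t.
    transitivity (c *: (\sum_(k < n.+1) b k *m Fr k (m t)) + \sum_(k < n.+1) b' k *m Fr k (m t)).
      by rewrite scaler_sumr -big_split; apply: eq_bigr => k _; rewrite mulmxDl scalemxAl.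
    by rewrite (Rb t) (Rb' t) scaler0 addr0.
  - move=> g r _ rE [b Rb <-]; exists (fun k => b k *m Fr k r).
      by move=> t; rewrite -[RHS](Rb (act g t)); apply: eq_bigr => k _; rewrite rE FrM mulmxA.
    by rewrite Fr_id.
  - by exists (a 0%N) => //; exists a.
pose bs i := s2val (cid2 (all (delta_mx 0 i))).
pose B k := \matrix_i bs i k.
have RB t : \sum_(k < n.+1) B k *m Fr k (m t) = 0.
  apply/row_matrixP => i; rewrite row0 raddf_sum /=.
  rewrite -[RHS](s2valP (cid2 (all (delta_mx 0 i))) t); apply: eq_bigr => k _.
  by rewrite row_mul rowK.
have B0 : B 0%N = 1%:M.
  apply/row_matrixP => i; rewrite rowK row1; exact: (s2valP' (cid2 (all (delta_mx 0 i)))).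
have RelM k' (C : nat -> 'M[K]_(k', d)) : (forall t, \sum_(k < n.+1) C k *m Fr k (m t) = 0) ->
    C 0%N = 0 -> forall k, (k < n.+1)%N -> C k = 0.
  move=> RC C0 k kn; apply/row_matrixP => i; rewrite row0.
  apply: (Rel0 (fun k => row i (C k))) => //; last by rewrite C0 row0.
  move=> t; have := congr1 (row i) (RC t); rewrite row0 raddf_sum /= => h; rewrite -[RHS]h.
  by apply: eq_bigr => l _; rewrite row_mul.
(* The difference of the two natural transforms of [B] by [g] is a relation with zero constant
   coefficient, so all its coefficients vanish. *)
have inter g : B n *m Fr n (rho g) = rho g *m B n.
  apply/eqP; rewrite -subr_eq0; apply/eqP.
  apply: (RelM _ (fun k => B k *m Fr k (rho g) - rho g *m B k)) => //; last first.
    by rewrite B0 mul1mx mulmx1 Fr_id subrr.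
  move=> t; under eq_bigr do rewrite mulmxBl -!mulmxA -FrM -rhoE.
  by rewrite sumrB -mulmx_sumr !RB mulmx0 subrr.
have Bfree : row_free (B n).
  rewrite -kermx_eq0; apply/eqP/row_matrixP => i; rewrite row0.
  set w := row i _.
  have wB : w *m B n = 0 by rewrite /w -row_mul mulmx_ker row0.
  rewrite -[w]mulmx1 -B0; apply: (IH (fun k => w *m B k)) => // t.
  have := congr1 (mulmx w) (RB t); rewrite mulmx0 mulmx_sumr big_ord_recr /= mulmxA wB.
  by rewrite mul0mx addr0 => h; rewrite -[RHS]h; apply: eq_bigr => k _; rewrite mulmxA.
have trE g : \tr (rho g) = d%:R.
  rewrite -(mxtrace1 K d) -rho1.
  apply: (conn (q := 'X^(p ^ n) - 'X) regG_trace) => [|h].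
    have pgt1 : (1 < p)%N by rewrite prime_gt1 // (pcharf_prime Kp).
    rewrite -size_poly_eq0 size_polyDl ?size_polyXn //.
    by rewrite size_polyN size_polyX ltnS; have := ltn_exp2l 0 n pgt1; rewrite expn0 n0.
  rewrite /root !(hornerD, hornerN, hornerX, hornerXn) -tr_Fr subr_eq0; apply/eqP.
  have -> : rho h = B n *m Fr n (rho h) *m invmx (B n).
    by rewrite inter mulmxK // -row_free_unit.
  rewrite mxtrace_mulC mulmxA mulVmx ?mul1mx; last by rewrite -row_free_unit.
  by rewrite inter mulmxK // -row_free_unit.
have [|||f f0 fP] := irreducible_mxtrace_fixed _ _ rho_irr d0.
- by move=> _ _ [g _ <-] [h _ <-]; exists (op g h); rewrite // rhoM.
- by exists e; rewrite // rho1.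
- by move=> _ [g _ <-].
have d1 : (d <= 1)%N.
  apply: (dmin (m' := fun t => f *m m t)) => //; split.
  - by apply: A_lin; exact: gfam_add gm.
  - move=> w wf; have : w *m f = 0 by apply: (gfam_indep gm) => t; rewrite -mulmxA wf.
    rewrite [w]mx11_scalar mul_scalar_mx => /eqP; rewrite scaler_eq0 (negPf f0) orbF.
    by move=> /eqP ->; rewrite raddf0.
  - by move=> g; exists 1%:M => t; rewrite mul1mx rhoE mulmxA fP //; exists g.
(* In dimension one every [a k] is a multiple of [Fr k f], so the relation becomes a nonzero
   p-polynomial vanishing on [f *m m]. *)
have full k : row_full (Fr k f).
  rewrite -col_leq_rank (leq_trans d1) // lt0n mxrank_eq0.
  by apply: contra_neq f0 => h; apply: (@Fr_inj k); rewrite h Fr0.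
have cP k : exists c : 'M[K]_1, a k = c *m Fr k f.
  by apply/submxP; exact: submx_full.
pose c k := sval (cid (cP k)) 0 0.
have cE k : a k = c k *: Fr k f.
  by rewrite [LHS](svalP (cid (cP k))) [sval _]mx11_scalar mul_scalar_mx.
pose u := \poly_(k < n.+1) c k.
have u0 : u != 0.
  apply: contra_neq a0 => u0; rewrite cE; have := congr1 (fun q : {poly K} => q`_0) u0.
  by rewrite coef_poly coef0 /= => ->; rewrite scale0r.
have Af : A (fun t => (f *m m t) 0 0) by apply: A_lin; exact: gfam_add gm.
have f0t : forall t, (f *m m t) 0 0 = 0.
  apply: (A_torsion_free Af u0) => t.
  rewrite /pev (psum_widen _ (size_poly _ _)).
  have := congr1 (fun X : 'M[K]_1 => X 0 0) (rel t); rewrite [X in _ = X]mxE => h; rewrite -[RHS]h.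
  rewrite summxE; apply: eq_bigr => k _; rewrite coef_poly ltn_ord cE -scalemxAl -FrM.
  by rewrite !mxE.
case/eqP: f0; apply: (gfam_indep gm) => t; apply/matrixP => i j.
by rewrite !ord1 f0t mxE.
Qed.
End Minimal.
Definition no_proot d (m : T -> 'cV[K]_d) := forall (w : 'rV_d) a, A a ->
  (forall t, (w *m m t) 0 0 = a t ^+ p) -> w = 0.

(* If [w *m m] is a p-th power in A for some nonzero [w] then by irreducibility so are all
   coordinates of [m], and they can be replaced by their p-th roots. This divides by [p]
   the degree of the first coordinate along a line on which it does not vanish. *)
Lemma gfam_no_proot : exists d (m : T -> 'cV[K]_d), [/\ (0 < d)%N, gfam m,
  forall d' (m' : T -> 'cV[K]_d'), (0 < d')%N -> gfam m' -> (d <= d')%N & no_proot m].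
Proof.
pose good d := `[< exists m : T -> 'cV[K]_d, (0 < d)%N /\ gfam m >].
have exg : exists d, good d by have [d [m [d0 gm]]] := gfam_exists; exists d; apply/asboolP; exists m.
have [d /asboolP[m [d0 gm]] dmin'] := ex_minnP exg.
have dmin d' (m' : T -> 'cV[K]_d') : (0 < d')%N -> gfam m' -> (d <= d')%N.
  by move=> d'0 gm'; apply: dmin'; apply/asboolP; exists m'.
have [r [b [bgen bfree]]] := generates_pfree Kp A_torsion_free A_generates.
have bsurj := pfree_surj bgen bfree.
have bD i : additive_fun (b i) by have [] := bgen.1 i.
pose i0 := Ordinal d0.
have [t1 mt1] : exists t, m t i0 0 != 0.
  apply: contrapT => h; have /matrixP/(_ 0 i0) : delta_mx 0 i0 = 0 :> 'rV[K]_d.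
    apply: (gfam_indep gm) => t; apply/matrixP => i j; rewrite !ord1 -rowE !mxE.
    by apply: contrapT => mt; apply: h; exists t; apply/eqP.
  by rewrite !mxE !eqxx => /eqP; rewrite oner_eq0.
have lineP h : R h -> exists q : {poly K}, forall s t, (forall i, b i t = s * b i t1) -> h t = q.[s].
  move=> Rh; have [F AF ->] : exists2 F, alg (range (@coord K 'I_r)) F & h = fun t => F (b^~ t).
    by apply: alg_factor; apply: alg_trans Rh => g; exact: bgen.2.
  have [q qE] := polyfun_line (b^~ t1) AF; exists q => s t bt.
  by rewrite -qE; congr F; apply/funext=> i; rewrite bt.
have [q qE] : exists q : {poly K}, forall s t, (forall i, b i t = s * b i t1) -> m t i0 0 = q.[s].
  by apply: lineP; have [] := gfam_add gm i0.
have [n] := ubnP (size q).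
elim: n m gm mt1 q qE => // n IH m gm mt1 q qE sq.
have [np|np] := pselect (no_proot m); first by exists d, m.
pose P (w : 'rV_d) := exists a, A a /\ forall t, (w *m m t) 0 0 = a t ^+ p.
have Q w : P w.
  move: w; apply: (gfam_irr gm dmin).
  - exists (fun=> 0); split; first by split; [move=> ? ?; rewrite addr0 | exact: AlgConst].
    by move=> t; rewrite mul0mx mxE -(expn1 p) (expr0_pX Kp).
  - move=> c u v [a [[aD Ra] aE]] [a' [[a'D Ra'] a'E]].
    exists (fun t => proot Kp 1 c * a t + a' t); split.
      split; last by apply: AlgAdd => //; exact: alg_scale.
      by have [_ _ h] := additive_space_full K T; apply: h.
    move=> t; rewrite mulmxDl -scalemxAl mxE [X in X + _]mxE aE a'E.
    by rewrite -[X in _ = _ ^+ X](expn1 p) (exprD_pX Kp) exprMn prootK expn1.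
  - move=> g rh w' rhE [a [Aa aE]]; exists (fun t => a (act g t)); split; first exact: A_act.
    by move=> t; rewrite -mulmxA -rhE aE.
  - apply: contrapT => h; apply: np => w' a Aa aE; apply: contrapT => w'0.
    by apply: h; exists w'; [exists a | apply/eqP].
pose a i := sval (cid (Q (delta_mx 0 i))).
have [Aa aE] : (forall i, A (a i)) /\ forall i t, m t i 0 = a i t ^+ p.
  split=> i; have [? h] := svalP (cid (Q (delta_mx 0 i))) => // t.
  by rewrite -h -rowE !mxE.
pose m' t : 'cV[K]_d := \col_i a i t.
have m'E t : Fr 1 (m' t) = m t by apply/colP => i; rewrite !mxE expn1 aE.
have gm' : gfam m'.
  split.
  - by move=> j; rewrite (_ : (fun _ => _) = a j) //; apply/funext=> t; rewrite mxE.
  - move=> w wm; apply: (@Fr_inj 1); rewrite Fr0; apply: (gfam_indep gm) => t.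
    by rewrite -m'E -FrM wm Fr0.
  - move=> g; have [rh rhE] := gfam_stable gm g; exists (Froot rh) => t.
    by apply: (@Fr_inj 1); rewrite m'E FrM FrootK m'E.
have [q' q'E] : exists q' : {poly K}, forall s t, (forall i, b i t = s * b i t1) -> m' t i0 0 = q'.[s].
  by apply: lineP; have [] := gfam_add gm' i0.
have qq' : q = q' ^+ p.
  apply/eqP; rewrite -subr_eq0; apply/eqP/poly_eq0_of_horner => s.
  have [t tE] := bsurj (fun i => s * b i t1).
  rewrite hornerD hornerN horner_exp -(qE s t tE) -(q'E s t tE) mxE aE.
  by rewrite subrr.
have m't1 : m' t1 i0 0 != 0.
  apply: contraNneq mt1; rewrite mxE aE => ->.
  by rewrite -(expn1 p) (expr0_pX Kp).
apply: (IH m' gm' m't1 q' q'E); rewrite ltnS in sq; apply: leq_trans sq.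
(* [q'] is zero at 0 and nonzero at 1, hence not constant, so that its p-th power [q] has strictly
   larger degree. *)
have q'1 : q'.[1] != 0 by rewrite -(q'E 1 t1) // => i; rewrite mul1r.
have q'0 : q'.[0] = 0.
  rewrite -(q'E 0 0); first by have [fD _] := gfam_add gm' i0; exact: (additive_fun0 fD).
  by move=> i; rewrite (additive_fun0 (bD i)) mul0r.
have sq' : (1 < size q')%N.
  rewrite ltnNge; apply/negP => /size1_polyC q'C; move: q'1 q'0.
  by rewrite q'C !hornerC => /negPf h /eqP; rewrite h.
have pgt1 : (1 < p)%N by rewrite prime_gt1 // (pcharf_prime Kp).
have q'n0 : q' != 0 by rewrite -size_poly_gt0 ltnW.
have q0 : q != 0 by rewrite qq' expf_neq0.
have : ((size q').-1 < (size q).-1)%N by rewrite qq' size_exp ltn_Pmulr // -subn1 subn_gt0.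
by rewrite -ltnS !prednK // size_poly_gt0.
Qed.

Lemma A_comb c f g : A f -> A g -> A (fun t => c * f t + g t).
Proof.
move=> [fD Rf] [gD Rg]; split; last by apply: AlgAdd => //; exact: alg_scale.
by have [_ _ h] := additive_space_full K T; apply: h.
Qed.

Lemma A_sub f g : A f -> A g -> A (fun t => f t - g t).
Proof.
move=> Af Ag; have := A_comb (-1) Ag Af; congr A; apply/funext=> t.
by rewrite mulN1r addrC.
Qed.

Lemma A_sum (I : Type) (s : seq I) (f : I -> T -> K) :
  (forall i, A (f i)) -> A (fun t => \sum_(i <- s) f i t).
Proof.
move=> Af; split; last by apply: alg_sum => i _; case: (Af i).
move=> u v; rewrite -big_split; apply: eq_bigr => i _; by case: (Af i) => fD _; rewrite fD.
Qed.

Lemma A_pev u f : A f -> A (fun t => pev p u (f t)).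
Proof.
move=> [fD Rf]; split; first by move=> s t; rewrite fD (pevD Kp).
by apply: alg_sum => i _; apply: alg_scale; exact: alg_exp.
Qed.

Lemma A_exp k f : A f -> A (fun t => f t ^+ (p ^ k)).
Proof.
move=> [fD Rf]; split; first by move=> s t; rewrite fD (exprD_pX Kp).
exact: alg_exp.
Qed.

Theorem simple_module_linear : exists d (m : T -> 'cV[K]_d),
  [/\ forall s t, m (s + t) = m s + m t,
      injective m,
      forall c, exists t, m t = c
    & forall g, exists rho : 'M_d, forall t, m (act g t) = rho *m m t] /\
  (forall j, R (fun t => m t j 0)) /\
  (forall i, exists F, alg (range (@coord K 'I_d)) F /\
     forall t, x t i 0 = F (fun j => m t j 0)).
Proof.
have [d [m [d0 gm dmin np]]] := gfam_no_proot.
pose mc (j : 'I_d) (t : T) : K := m t j 0.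
have mA j : A (mc j) := gfam_add gm j.
have mD := gfamD (gfam_add gm).
have mker t : (forall j, mc j t = 0) -> t = 0.
  have [//|g s h j|inj|mc0] := @irr d mc; last 2 first.
  - exact: inj.
  - have : delta_mx 0 (Ordinal d0) = 0 :> 'rV[K]_d.
      apply: (gfam_indep gm) => s; apply/matrixP => i j; rewrite !ord1 -rowE !mxE.
      exact: mc0.
    move/matrixP/(_ 0 (Ordinal d0)); rewrite !mxE !eqxx => /eqP; by rewrite oner_eq0.
  - have [rh rhE] := gfam_stable gm g; rewrite /mc rhE mxE big1 // => i _.
    by rewrite [m s i 0]h mulr0.
have minj : injective m.
  move=> s t mst; apply/eqP; rewrite -subr_eq0; apply/eqP/mker => j.
  have [fD _] := mA j; rewrite fD (additive_funN _ fD) /mc mst subrr //.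
have mfree : pfree p mc.
  move=> u rel j; apply/polyP => k; rewrite coef0.
  pose n := \max_j size (u j).
  have sn i : (size (u i) <= n)%N by rewrite /n (bigD1 i) //= leq_maxl.
  have [kn|nk] := ltnP k n; last by rewrite nth_default // (leq_trans (sn j)).
  (* Relations sorted by powers of F, as in [gfam_free]: the k-th coefficients of all [u i] form one
     row vector. *)
  have : \row_i (u i)`_k = 0.
    apply: (gfam_free d0 gm dmin (n := n) (a := fun k => \row_i (u i)`_k)) => // t.
    apply/matrixP => i' j'; rewrite !ord1 summxE mxE -[RHS](rel t).
    under [RHS]eq_bigr do rewrite /pev (psum_widen _ (sn _)).
    rewrite exchange_big; apply: eq_bigr => l _; rewrite mxE; apply: eq_bigr => i _.
    by rewrite !mxE.
  by move/rowP/(_ j); rewrite !mxE.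
have [r [b [bgen bfree]]] := generates_pfree Kp A_torsion_free A_generates.
have bsurj := pfree_surj bgen bfree.
have span a : A a -> exists u : 'I_d -> {poly K}, forall t, a t = \sum_j pev p (u j) (mc j t).
  move=> Aa.
  have [k [u uE]] : exists k (u : 'I_d -> {poly K}), forall t, a t ^+ (p ^ k) = \sum_j pev p (u j) (mc j t).
    apply: (additive_nullstellensatz Kp bsurj) => [j||t mt].
    - exact: (A_span bgen bfree).
    - exact: (A_span bgen bfree).
    - by rewrite (mker t mt); have [aD _] := Aa; exact: additive_fun0.
  elim: k u uE => [|k IH] u uE; first by exists u => t; rewrite -uE expn0 expr1.
  (* [u j] is its constant term plus F composed with [v j]. So [w *m m] is the p-th power of [f] in
     A, [no_proot] gives [w = 0], and one Frobenius is stripped off. *)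
  pose v j := \poly_(i < size (u j)) proot Kp 1 (u j)`_i.+1.
  have uv j : u j = ((u j)`_0)%:P + pfrob p 1 (v j).
    apply/polyP => -[|i]; rewrite coefD coefC /pfrob coefXnM /= ?addr0 //.
    rewrite subn1 /= add0r coef_poly.
    have vE : (v j)`_i ^+ (p ^ 1) = (u j)`_i.+1.
      rewrite coef_poly; case: ltnP => h; first by rewrite prootK.
      by rewrite (expr0_pX Kp) nth_default // (leq_trans h).
    by case: ltnP => h; rewrite -vE // nth_default // (expr0_pX Kp).
  apply: (IH v) => t.
  pose w := \row_j (u j)`_0.
  pose f s := a s ^+ (p ^ k) - \sum_j pev p (v j) (mc j s).
  have Af : A f.
    apply: A_sub; first exact: A_exp.
    by apply: A_sum => j; exact: A_pev.
  have wf s : (w *m m s) 0 0 = f s ^+ p.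
    apply: (addIr ((\sum_j pev p (v j) (mc j s)) ^+ (p ^ 1))).
    rewrite -[X in _ = _ ^+ X + _](expn1 p) -(exprD_pX Kp) subrK -exprM -expnD addn1 uE.
    rewrite mxE (expr_sum_pX Kp) -big_split; apply: eq_bigr => j _.
    rewrite [X in _ = pev _ X _]uv [RHS]psumD -!/(pev _ _ _) pevC (pev_frob Kp).
    by rewrite [w 0 j]mxE.
  have w0 : w = 0 by apply: np Af wf.
  apply/eqP; rewrite -subr_eq0; have /esym/eqP := wf t.
  by rewrite w0 mul0mx mxE expf_eq0 => /andP[].
have genm : generates (range xcoord) mc.
  split=> // g /bgen.2; apply: alg_trans => _ [i _ <-].
  have [u uE] := span _ (bgen.1 i).
  apply: (@alg_eq _ _ _ (fun t => \sum_j pev p (u j) (mc j t))) => [|t]; last by rewrite uE.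
  apply: alg_sum => j _; apply: alg_sum => k _; apply: alg_scale; apply: alg_exp.
  by apply: AlgGen; exists j.
exists d, m; split; last split.
- split=> //; last exact: gfam_stable gm.
  move=> c; have [t tc] := pfree_surj genm mfree (fun j => c j 0).
  by exists t; apply/colP => j; exact: tc.
- by move=> j; have [] := mA j.
- move=> i; have [|F AF FE] := @alg_factor _ _ _ mc (xcoord i).
    by apply: genm.2; exists i.
  by exists F; split=> // t; rewrite -/(xcoord i t) FE.
Qed.
End Families.
End SimpleModule.

(** * Polynomial functions on matrices *)

Section MatrixPolynomials.
Variable K : closedFieldType.

Lemma alg_meval N (F : ('I_N -> K) -> K) : alg (range (@coord K 'I_N)) F ->
  exists P : {mpoly K[N]}, forall z, F z = P.@[z].
Proof.
elim=> [_ [i _ <-]|c|f g _ [P PE] _ [Q QE]|f g _ [P PE] _ [Q QE]].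
- by exists 'X_i => z; rewrite mevalXU.
- by exists c%:MP => z; rewrite mevalC.
- by exists (P + Q) => z; rewrite mevalD PE QE.
- by exists (P * Q) => z; rewrite mevalM PE QE.
Qed.

Lemma meval_alg N (P : {mpoly K[N]}) : alg (range (@coord K 'I_N)) (fun z => P.@[z]).
Proof.
apply: (@alg_eq _ _ _ (fun z => \sum_(m <- msupp P) P@_m * \prod_i z i ^+ m i)).
  apply: alg_sum => m _; apply: alg_scale; apply: alg_prod => i _; apply: alg_exp.
  by apply: AlgGen; exists i.
by move=> z; rewrite mevalE.
Qed.

Definition amx (X : Type) (gen : set (X -> K)) a b (M : X -> 'M[K]_(a, b)) :=
  forall i j, alg gen (fun x => M x i j).

Section MatrixValued.
Variables (X : Type) (gen : set (X -> K)).

Lemma amx_cst a b (M : 'M_(a, b)) : amx gen (fun=> M).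
Proof. by move=> i j; exact: AlgConst. Qed.

Lemma amx_mul a b c (M : X -> 'M_(a, b)) (M' : X -> 'M_(b, c)) :
  amx gen M -> amx gen M' -> amx gen (fun x => M x *m M' x).
Proof.
move=> hM hM' i j; apply: (@alg_eq _ _ _ (fun x => \sum_k M x i k * M' x k j)).
  by apply: alg_sum => k _; exact: AlgMul.
by move=> x; rewrite mxE.
Qed.

Lemma amx_sub a b (M M' : X -> 'M_(a, b)) :
  amx gen M -> amx gen M' -> amx gen (fun x => M x - M' x).
Proof.
move=> hM hM' i j; apply: (alg_eq (alg_sub (hM i j) (hM' i j))) => x.
by rewrite !mxE.
Qed.

Lemma amx_exp a (M : X -> 'M_a) k : amx gen M -> amx gen (fun x => M x ^+ k).
Proof.
move=> hM; elim: k => [|k IH] i j; first exact: amx_cst.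
apply: (alg_eq (amx_mul hM IH i j)) => x; by rewrite exprS mulmxE.
Qed.

Lemma alg_det a (M : X -> 'M_a) : amx gen M -> alg gen (fun x => \det (M x)).
Proof.
move=> hM; rewrite /determinant; apply: alg_sum => s _; apply: alg_scale.
by apply: alg_prod => i _; exact: hM.
Qed.

Lemma amx_adj a (M : X -> 'M_a) : amx gen M -> amx gen (fun x => \adj (M x)).
Proof.
move=> hM i j; apply: (@alg_eq _ _ _ (fun x => cofactor (M x) j i)); last first.
  by move=> x; rewrite mxE.
apply: alg_scale; apply: alg_det => k l.
by apply: (alg_eq (hM (lift j k) (lift i l))) => x; rewrite !mxE.
Qed.
End MatrixValued.

Variable n : nat.

Definition entry (k : 'I_(n * n)) (M : 'M[K]_n) := mxvec M 0 k.

Lemma amx_entry : amx (range entry) id.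
Proof.
move=> i j; apply: (@alg_eq _ _ _ (entry (mxvec_index i j))); last first.
  by move=> x; rewrite /entry mxvecE.
by apply: AlgGen; exists (mxvec_index i j).
Qed.

Lemma alg_mxeval F : alg (range entry) F -> exists P, forall x, F x = mxeval P x.
Proof.
move=> /alg_factor[H /alg_meval[P PE] ->].
by exists P => x; rewrite PE.
Qed.

Lemma GL_closedI (A : set 'M[K]_n) (I : Type) (F : I -> 'M[K]_n -> K) : GL_closed A ->
  (forall i, alg (range entry) (F i)) -> GL_closed [set x | A x /\ forall i, F i x = 0].
Proof.
move=> [S ->] AF.
pose P i := sval (cid (alg_mxeval (AF i))).
have PE i x : F i x = mxeval (P i) x := svalP (cid (alg_mxeval (AF i))) x.
exists (S `|` range P); apply/seteqP; split=> x /=.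
  by move=> [[xu xS] xF]; split=> // f [/xS //|[i _ <-]]; rewrite -PE.
move=> [xu h]; split; first by split=> // f Sf; apply: h; left.
by move=> i; rewrite PE; apply: h; right; exists i.
Qed.

Lemma closed_subgroup_unit (A : set 'M[K]_n) x : closed_subgroup A -> A x -> x \in unitmx.
Proof. by move=> [[S ->]] _ _ _ []. Qed.

Lemma invmxM (x y : 'M[K]_n) : x \in unitmx -> y \in unitmx ->
  invmx (x *m y) = invmx y *m invmx x.
Proof.
move=> xu yu; have xyu : x *m y \in unitmx by rewrite unitmx_mul xu.
by rewrite -[RHS](mulmxK xyu) !mulmxA -(mulmxA _ (invmx x)) mulVmx // mulmx1 mulVmx // mul1mx.
Qed.

(* The fibre through the identity and the union of the other fibres are closed. *)
Lemma connected_constant (A : set 'M[K]_n) (phi : 'M[K]_n -> K) (F : 'M[K]_n -> K) k (q : {poly K}) :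
    closed_subgroup A -> GL_connected A -> alg (range entry) F ->
    (forall g, A g -> phi g * \det g ^+ k = F g) -> q != 0 ->
    (forall g, A g -> root q (phi g)) ->
  forall g, A g -> phi g = phi 1.
Proof.
move=> Asg Aconn AF phiE q0 rootq g Ag.
have detn0 h : A h -> \det h ^+ k != 0.
  by move=> Ah; rewrite expf_neq0 // -unitfE -unitmxE (closed_subgroup_unit Asg).
have [rs qE] := closed_field_poly_normal q.
have phirs h : A h -> phi h \in rs.
  by move=> /rootq; rewrite qE rootZ ?lead_coef_eq0 // root_prod_XsubC.
have Adet : alg (range entry) (fun h : 'M[K]_n => \det h ^+ k).
  by apply: alg_exp; apply: alg_det; exact: amx_entry.
(* Equations of the two parts after multiplication by the nonvanishing denominator [\det h ^+ k]. *)
pose f1 (_ : unit) h := F h - phi 1 * \det h ^+ k.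
pose f2 (_ : unit) h := \prod_(z <- rs | z != phi 1) (F h - z * \det h ^+ k).
have f1E h : A h -> f1 tt h = (phi h - phi 1) * \det h ^+ k.
  by move=> Ah; rewrite /f1 -phiE // mulrBl.
have [||||B0|C0] := Aconn [set h | A h /\ forall u, f1 u h = 0] [set h | A h /\ forall u, f2 u h = 0].
- by apply: GL_closedI => [|u]; [exact: csg_closed | apply: alg_sub => //; exact: alg_scale].
- apply: GL_closedI => [|u]; first exact: csg_closed.
  by apply: alg_prod => z _; apply: alg_sub => //; exact: alg_scale.
- apply/seteqP; split=> h /=; last by case=> -[].
  move=> Ah; have [e|ne] := eqVneq (phi h) (phi 1); [left | right]; split=> // -[].
    by rewrite f1E // e subrr mul0r.
  apply/eqP; rewrite prodf_seq_eq0; apply/hasP; exists (phi h); first exact: phirs.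
  by rewrite ne /= -phiE // subrr.
- apply/seteqP; split=> h //= [[Ah /(_ tt) h1] [_ /(_ tt) h2]].
  move: h1; rewrite f1E // => /eqP; rewrite mulf_eq0 (negPf (detn0 _ Ah)) orbF subr_eq0 => /eqP e.
  move/eqP: h2; rewrite prodf_seq_eq0 => /hasP[z _ /andP[z1]].
  by rewrite -phiE // -mulrBl mulf_eq0 (negPf (detn0 _ Ah)) orbF subr_eq0 e eq_sym (negPf z1).
- have : [set h | A h /\ forall u, f1 u h = 0] 1.
    by split=> [|[]]; [exact: csg_one | rewrite f1E ?subrr ?mul0r //; exact: csg_one].
  by rewrite B0.
- have [//|ne] := eqVneq (phi g) (phi 1).
  have : [set h | A h /\ forall u, f2 u h = 0] g.
    split=> // -[]; apply/eqP; rewrite prodf_seq_eq0; apply/hasP; exists (phi g); first exact: phirs.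
    by rewrite ne /= -phiE // subrr.
  by rewrite C0.
Qed.

End MatrixPolynomials.

(** * Irreducible unipotent matrix groups *)

Section IrreducibleUnipotent.
Variables (K : closedFieldType) (p : nat) (n : nat) (V G : set 'M[K]_n).
Hypothesis Kp : p \in [pchar K].
Hypothesis V_unip : unipotent p V.
Hypothesis G_alg : closed_subgroup G.
Hypothesis GV : conj_invariant G V.
Hypothesis V_irr : forall W : set 'M[K]_n, closed_subgroup W -> W `<=` V ->
  conj_invariant G W -> W = [set 1] \/ W = V.

Let V_alg : closed_subgroup V := V_unip.1.
Let Vu v : V v -> v \in unitmx := closed_subgroup_unit V_alg (x := v).
Let Gu g : G g -> g \in unitmx := closed_subgroup_unit G_alg (x := g).

Lemma conjmxM (g a b : 'M[K]_n) : g \in unitmx ->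
  g * (a * b) * invmx g = (g * a * invmx g) * (g * b * invmx g).
Proof. by move=> gu; rewrite -!mulmxE !mulmxA mulmxKV. Qed.

Lemma conjmxX (g a : 'M[K]_n) k : g \in unitmx ->
  (g * a * invmx g) ^+ k = g * a ^+ k * invmx g.
Proof.
move=> gu; elim: k => [|k IH]; first by rewrite !expr0 mulr1 -mulmxE mulmxV.
by rewrite !exprS IH conjmxM.
Qed.

Lemma irr_unip_abelian u v : V u -> V v -> u * v = v * u.
Proof.
move=> Vx Vy; have [V1|Vn1] := pselect (V = [set 1]).
  by move: Vx Vy; rewrite V1 /= => -> ->.
have [z [Vz z1 zC]] := unipotent_center Kp (csg_one V_alg) (csg_mul V_alg)
  (csg_inv V_alg) Vu V_unip.2 Vn1.
pose I := {w : 'M[K]_n | V w} * 'I_n * 'I_n : Type.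
pose F (i : I) x := (x *m sval i.1.1 - sval i.1.1 *m x) i.1.2 i.2.
pose Z := [set x | V x /\ forall i, F i x = 0].
have ZP x : Z x <-> V x /\ forall w, V w -> x * w = w * x.
  split=> [[Vx' h]|[Vx' h]]; split=> //.
    move=> w Vw; apply/eqP; rewrite -subr_eq0; apply/eqP/matrixP => i j.
    by have := h (exist V w Vw, i, j); rewrite /F /= => ->; rewrite mxE.
  by move=> [[[w Vw] i] j]; rewrite /F /= !mulmxE h // subrr mxE.
have Zcl : closed_subgroup Z.
  split.
  - apply: GL_closedI => [|[[w i] j]]; first exact: csg_closed.
    apply: amx_sub; apply: amx_mul; try exact: amx_cst; exact: amx_entry.
  - apply/ZP; split; first exact: csg_one.
    by move=> w _; rewrite mulr1 mul1r.
  - move=> x y /ZP[Vx' xC] /ZP[Vy' yC]; apply/ZP; split; first exact: csg_mul.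
    by move=> w Vw; rewrite -mulrA yC // mulrA xC // mulrA.
  - move=> x /ZP[Vx' xC]; apply/ZP; split; first exact: csg_inv.
    move=> w Vw; have xu := Vu Vx'; rewrite -!mulmxE.
    rewrite -[RHS](mulKmx xu) [x *m _]mulmxA; congr (_ *m _).
    by rewrite mulmxE xC // -mulmxE mulmxK.
have ZG : conj_invariant G Z.
  move=> g a Gg /ZP[Va aC]; apply/ZP; split; first exact: GV.
  move=> w Vw; have gu := Gu Gg.
  have giu : invmx g \in unitmx by rewrite unitmx_inv.
  pose w' := invmx g * w * g.
  have Vw' : V w'.
    by have := GV (csg_inv G_alg Gg) Vw; rewrite invmxK.
  have wE : w = g * w' * invmx g by rewrite /w' -!mulmxE !mulmxA mulmxV // mul1mx mulmxK.
  by rewrite wE -!conjmxM // aC.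
have ZV : Z `<=` V by move=> x [].
have [Z1|ZVE] := V_irr Zcl ZV ZG.
  by case: z1; have : Z z; [apply/ZP | rewrite Z1].
by have : Z u; [rewrite ZVE | move/ZP => [_]; exact].
Qed.

Lemma irr_unip_exponent v : V v -> v ^+ p = 1.
Proof.
move=> Vx; have [V1|Vn1] := pselect (V = [set 1]).
  by move: Vx; rewrite V1 /= => ->; rewrite expr1n.
have VX x k : V x -> V (x ^+ k).
  move=> Vx'; elim: k => [|k IH]; first exact: csg_one.
  by rewrite exprS; apply: csg_mul.
have [w Vw w1] : exists2 w, V w & w <> 1.
  apply: contrapT => h; apply: Vn1; apply/seteqP; split=> x /=.
    by move=> Vx'; apply: contrapT => x1; apply: h; exists x.
  by move=> ->; exact: csg_one.
(* The last nontrivial term of the sequence [w ^+ (p ^ i)] has order p. *)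
have [z [Vz z1 zp]] : exists z, [/\ V z, z <> 1 & z ^+ p = 1].
  have [k wk] := V_unip.2 _ Vw; elim: k w Vw w1 wk => [|k IH] w Vw w1.
    by rewrite expn0 expr1.
  rewrite expnS exprM => wk; have [wp|wp] := pselect (w ^+ p = 1); first by exists w.
  by apply: (IH (w ^+ p)) => //; exact: VX.
pose F (ij : 'I_n * 'I_n) (x : 'M[K]_n) := (x ^+ p - 1%:M) ij.1 ij.2.
pose W := [set x | V x /\ forall i, F i x = 0].
have WP x : W x <-> V x /\ x ^+ p = 1.
  split=> [[Vx' h]|[Vx' h]]; split=> //.
    apply/eqP; rewrite -subr_eq0; apply/eqP/matrixP => i j.
    by have := h (i, j); rewrite /F /= => ->; rewrite mxE.
  by move=> [i j]; rewrite /F /= h subrr mxE.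
have Wcl : closed_subgroup W.
  split.
  - apply: GL_closedI => [|[i j]]; first exact: csg_closed.
    by apply: amx_sub; [apply: amx_exp; exact: amx_entry | exact: amx_cst].
  - by apply/WP; split; [exact: csg_one | rewrite expr1n].
  - move=> x y /WP[Vx' xp] /WP[Vy' yp]; apply/WP; split; first exact: csg_mul.
    by rewrite exprMn_comm ?xp ?yp ?mulr1 //; exact: irr_unip_abelian.
  - move=> x /WP[Vx' xp]; apply/WP; split; first exact: csg_inv.
    have xu := Vu Vx'.
    have xC : GRing.comm x (invmx x) by rewrite /GRing.comm -!mulmxE mulmxV // mulVmx.
    rewrite -[LHS]mul1r -xp -exprMn_comm //.
    by rewrite -mulmxE mulmxV // expr1n xp.
have WG : conj_invariant G W.
  move=> g a Gg /WP[Va ap]; apply/WP; split; first exact: GV.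
  by rewrite conjmxX ?Gu // ap mulr1 -mulmxE mulmxV // Gu.
have [W1|WVE] := V_irr Wcl (fun x => @proj1 _ _) WG.
  by case: z1; have : W z; [apply/WP | rewrite W1].
by have : W v; [rewrite WVE | move/WP => []].
Qed.

Section Infinite.
Hypothesis G_conn : GL_connected G.
Hypothesis Vinf : ~ finite_set V.

(** The boolean predicate makes this a subtype with injective [val]; it carries the matrix product
    as addition. *)
Let Vt := {v : 'M[K]_n | `[< V v >]}.
Let VtV (u : Vt) : V (val u). Proof. exact: (asboolW (valP u)). Qed.
Let mkV v (Vv : V v) : Vt := exist _ v (asboolT Vv).

Let addV (u v : Vt) : Vt := mkV (csg_mul V_alg (VtV u) (VtV v)).
Let oppV (u : Vt) : Vt := mkV (csg_inv V_alg (VtV u)).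
Let zeroV : Vt := mkV (csg_one V_alg).

Let addVA : associative addV.
Proof. by move=> u v w; apply: val_inj; rewrite /= mulrA. Qed.
Let addVC : commutative addV.
Proof. by move=> u v; apply: val_inj; apply: irr_unip_abelian; exact: VtV. Qed.
Let add0V : left_id zeroV addV.
Proof. by move=> u; apply: val_inj; rewrite /= mul1r. Qed.
Let addNV : left_inverse zeroV oppV addV.
Proof. by move=> u; apply: val_inj; rewrite /= -mulmxE mulVmx // Vu //; exact: VtV. Qed.

Let Vc : choiceType := HB.pack Vt (gen_eqMixin Vt) (gen_choiceMixin Vt).
Let T : zmodType := HB.pack Vt (Choice.class Vc) (GRing.isZmodule.Build Vc addVA addVC add0V addNV).

Let X (t : T) : 'M[K]_n := val (t : Vt).
Let x (t : T) : 'cV[K]_(n * n) := (mxvec (X t))^T.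

Let XD s t : X (s + t) = X s * X t. Proof. by []. Qed.
Let X0 : X 0 = 1. Proof. by []. Qed.

Let XV t : V (X t). Proof. exact: VtV. Qed.
Let X_inj : injective X. Proof. exact: val_inj. Qed.
Let X_surj v : V v -> exists t, X t = v.
Proof. by move=> Vv; exists (mkV Vv : Vt). Qed.
Let xE t i : x t i 0 = entry i (X t). Proof. by rewrite mxE. Qed.

Let x_lin_mulr (B : 'M[K]_n) : exists M : 'M_(n * n), forall A : 'M[K]_n,
  (mxvec (A *m B))^T = M *m (mxvec A)^T.
Proof.
exists (lin_mx (mulmxr B))^T => A.
by rewrite -trmx_mul mul_vec_lin.
Qed.

Let x_lin_mull (B : 'M[K]_n) : exists M : 'M_(n * n), forall A : 'M[K]_n,
  (mxvec (B *m A))^T = M *m (mxvec A)^T.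
Proof.
exists (lin_mx (mulmx B))^T => A.
by rewrite -trmx_mul mul_vec_lin.
Qed.

Let Tp (t : T) : t *+ p = 0.
Proof.
have XX k : X (t *+ k) = X t ^+ k.
  by elim: k => [|k IH] //; rewrite mulrS XD IH exprS.
by apply: X_inj; rewrite XX irr_unip_exponent.
Qed.

(** The difference by [v] of [w *m X t] is the same function with [w *m (X v - 1%:M)] for [w], so
    Kolchin's filtration bounds the degree. *)
Let x_deg i : exists m, dle m (fun t => x t i 0).
Proof.
have [|m mP] := @unip_rep_killed K p Vt addV zeroV Kp n (fun u : Vt => val u).
  split=> [//|u v|u]; first by rewrite mulmxE.
  exact: V_unip.2 _ (VtV u).
have deg j (w : 'rV[K]_n) b : killed (fun u : Vt => val u) j w ->
    dle j (fun t : T => (w *m X t) 0 b).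
  have dW (v : T) (w' : 'rV[K]_n) : delta v (fun t => (w' *m X t) 0 b) =
      fun t => (w' *m (X v - 1%:M) *m X t) 0 b.
    apply/funext=> t; rewrite /delta [t + v]addrC XD -mulmxE mulmxBr mulmx1 mulmxBl mulmxA.
    by rewrite [RHS]mxE [X in _ = _ + X]mxE.
  elim: j w => [|[|j] IH] w.
  - by move=> /= -> t; rewrite !mul0mx.
  - move=> /= kw; apply: symb_inS; first exact: additive_space_full.
    move=> t; apply/eqP; rewrite -subr_eq0; apply/eqP.
    have := congr1 (fun f => f 0) (dW t w); rewrite /delta add0r => ->.
    by rewrite kw mul0mx mxE.
  - by move=> kw; rewrite /dle symb_inSS => v; rewrite dW; apply: IH; exact: kw.
exists m; case/mxvec_indexP: i => a b.
have := deg m (delta_mx 0 a) b (mP _); congr dle; apply/funext=> t.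
by rewrite xE /entry mxvecE -rowE mxE.
Qed.

Let alg_x_entry f : alg (range (fun i t => x t i 0)) f ->
  exists2 F, alg (range (@entry K n)) F & forall t, f t = F (X t).
Proof.
move=> /alg_factor[H AH ->]; exists (fun M => H (fun i => entry i M)).
  by apply: (@alg_subst _ _ _ (@entry K n)) AH => i; apply: AlgGen; exists i.
by move=> t; congr H; apply/funext=> i; rewrite xE.
Qed.

(** The equations of [V] hold only among invertible matrices. Invertibility of the limit point [Y]
    comes from the polynomial [\det - 1], which vanishes on [V] because a p-power root of 1 in [K]
    is 1. *)
Let x_closed (y : 'cV[K]_(n * n)) :
  (forall F, alg (range (@coord K 'I_(n * n))) F ->
     (forall t, F (fun i => x t i 0) = 0) -> F (fun i => y i 0) = 0) ->
  exists t, x t = y.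
Proof.
move=> yF; pose Y : 'M[K]_n := vec_mx y^T.
have YE : (fun i => y i 0) = (fun i => mxvec Y 0 i).
  by apply/funext=> i; rewrite vec_mxK mxE.
have xXE t : (fun i => x t i 0) = (fun i => mxvec (X t) 0 i) by apply/funext=> i; rewrite xE.
have yF' F : alg (range (@coord K 'I_(n * n))) F ->
    (forall t, F (fun i => mxvec (X t) 0 i) = 0) -> F (fun i => mxvec Y 0 i) = 0.
  by move=> AF F0; rewrite -YE; apply: yF => // t; rewrite xXE.
suff VY : V Y.
  have [t tE] := X_surj VY; exists t; apply/matrixP => i j; rewrite !ord1 xE tE.
  by have := congr1 (fun f => f i) YE.
have [[S VE] _ _ _] := V_alg; rewrite VE /=; split.
  have detP : alg (range (@coord K 'I_(n * n)))
      (fun z => \det (\matrix_(i < n, j < n) z (mxvec_index i j)) - 1).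
    apply: alg_sub; last exact: AlgConst.
    apply: alg_det => i j; apply: (@alg_eq _ _ _ (coord (mxvec_index i j))).
      by apply: AlgGen; exists (mxvec_index i j).
    by move=> z; rewrite mxE.
  have mxE' (A : 'M[K]_n) : \matrix_(i, j) mxvec A 0 (mxvec_index i j) = A.
    by apply/matrixP => i j; rewrite mxE mxvecE.
  have /= := yF' _ detP; rewrite mxE' => h.
  rewrite unitmxE unitfE; have -> : \det Y = 1; last exact: oner_neq0.
  apply/eqP; rewrite -subr_eq0; apply/eqP/h => t; rewrite mxE'.
  apply/eqP; rewrite subr_eq0; apply/eqP.
  have [k Xk] := V_unip.2 _ (XV t); apply: (expr_pX_inj Kp (k := k)) => /=.
  have detX l : \det (X t ^+ l) = \det (X t) ^+ l.
    by elim: l => [|l IH]; rewrite ?expr0 ?det1 // !exprS -mulmxE det_mulmx IH.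
  by rewrite -detX Xk det1 expr1n.
move=> f Sf; apply: (yF' _ (meval_alg f)) => t.
by have := XV t; rewrite VE /= => -[_]; apply.
Qed.

Let Gt := {g : 'M[K]_n | G g}.
Let opG (g h : Gt) : Gt := exist _ _ (csg_mul G_alg (svalP g) (svalP h)).
Let oneG : Gt := exist _ _ (csg_one G_alg).
Let act (g : Gt) (t : T) : T := (mkV (GV (svalP g) (XV t)) : Vt).

Let actE g t : X (act g t) = sval g *m X t *m invmx (sval g). Proof. by []. Qed.

(** Since the inverse of [g] is its adjugate over its determinant, a function in [regG] is a
    polynomial divided by a power of [\det], the form handled by [connected_constant]. *)
Let conn (phi : Gt -> K) (q : {poly K}) : regG x act phi -> q != 0 ->
  (forall g, root q (phi g)) -> forall g, phi g = phi oneG.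
Proof.
move=> Rphi q0 rootq.
have detn0 (g : Gt) : \det (sval g) != 0.
  by rewrite -unitfE -unitmxE; apply: Gu; exact: svalP.
have [k [F [AF FE]]] : exists k F, alg (range (@entry K n)) F /\
    forall g : Gt, phi g * \det (sval g) ^+ k = F (sval g).
  have Adet l : alg (range (@entry K n)) (fun h : 'M[K]_n => \det h ^+ l).
    by apply: alg_exp; apply: alg_det; exact: amx_entry.
  elim: Rphi => [f [i [t fE]]|c|f g _ [k [F [AF FE]]] _ [l [H [AH HE]]]
      |f g _ [k [F [AF FE]]] _ [l [H [AH HE]]]].
  - case/mxvec_indexP: i fE => a b fE.
    exists 1%N, (fun h => (h *m X t *m \adj h) a b); split.
      apply: amx_mul; last by apply: amx_adj; exact: amx_entry.
      by apply: amx_mul; [exact: amx_entry | exact: amx_cst].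
    move=> g; rewrite fE xE /entry mxvecE actE /invmx Gu; last exact: svalP.
    by rewrite -scalemxAr mxE expr1 mulrC mulVKf.
  - by exists 0%N, (fun=> c); split=> [|g]; [exact: AlgConst | rewrite expr0 mulr1].
  - exists (k + l)%N, (fun h => F h * \det h ^+ l + H h * \det h ^+ k); split.
      by apply: AlgAdd; apply: AlgMul.
    by move=> h; rewrite -FE -HE exprD; ring.
  - exists (k + l)%N, (fun h => F h * H h); split; first exact: AlgMul.
    by move=> h; rewrite -FE -HE exprD; ring.
pose phi' (M : 'M[K]_n) := F M / \det M ^+ k.
have phi'E (g : Gt) : phi g = phi' (sval g).
  by rewrite /phi' -FE mulfK // expf_neq0.
move=> g; rewrite !phi'E.
apply: (connected_constant (F := F) (k := k) (q := q) G_alg G_conn) => //; last exact: svalP.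
- by move=> h Gh; have := phi'E (exist _ h Gh); rewrite /= => <-; exact: (FE (exist _ h Gh)).
- by move=> h Gh; have := phi'E (exist _ h Gh); rewrite /= => <-; exact: rootq.
Qed.

(** The common kernel of the [m j] is a closed invariant subgroup of [V]. *)
Let irr d (m : 'I_d -> T -> K) : (forall j, addR (range (fun i t => x t i 0)) (m j)) ->
  (forall g t, (forall j, m j t = 0) -> forall j, m j (act g t) = 0) ->
  (forall t, (forall j, m j t = 0) -> t = 0) \/ (forall t j, m j t = 0).
Proof.
move=> Am mst.
have FP j : exists F, alg (range (@entry K n)) F /\ forall t, m j t = F (X t).
  by have [F AF FE] := alg_x_entry (Am j).2; exists F.
pose F j := sval (cid (FP j)).
have [AF FE] : (forall j, alg (range (@entry K n)) (F j)) /\ forall j t, m j t = F j (X t).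
  by split=> j; have [] := svalP (cid (FP j)).
pose W := [set v | V v /\ forall j, F j v = 0].
have WP t : W (X t) <-> forall j, m j t = 0.
  split=> [[_ h] j|h]; first by rewrite FE.
  by split=> // j; rewrite -FE.
have mD j : additive_fun (m j) by case: (Am j).
have Wcl : closed_subgroup W.
  split.
  - by apply: GL_closedI => //; exact: csg_closed.
  - by rewrite -X0; apply/WP => j; exact: additive_fun0.
  - move=> _ _ [/X_surj[s <-] hs] [/X_surj[t <-] ht]; rewrite -XD; apply/WP => j.
    by rewrite mD !FE hs ht addr0.
  - move=> _ [/X_surj[s <-] hs]; have -> : invmx (X s) = X (- s) by [].
    by apply/WP => j; rewrite additive_funN // FE hs oppr0.
have WG : conj_invariant G W.
  move=> g _ Gg [/X_surj[s <-] hs].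
  have -> : g * X s * invmx g = X (act (exist _ g Gg) s) by [].
  by apply/WP; apply: mst => j; rewrite FE hs.
have [W1|WV] := V_irr Wcl (fun v => @proj1 _ _) WG; [left | right] => t.
  by move=> /WP; rewrite W1 /= => Xt; apply: X_inj; rewrite Xt.
by apply/WP; rewrite WV.
Qed.

Let Tinf (f : T -> K) (q : {poly K}) :
  injective f -> q != 0 -> (forall t, root q (f t)) -> False.
Proof.
move=> finj q0 rootq; apply: Vinf.
have [rs qE] := closed_field_poly_normal q.
have frs t : f t \in rs.
  by have := rootq t; rewrite {1}qE rootZ ?lead_coef_eq0 // root_prod_XsubC.
have -> : V = X @` (f @^-1` [set` rs]).
  apply/seteqP; split=> v /=; last by move=> [t _ <-].
  by move=> /X_surj[t <-]; exists t => //; exact: frs.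
by apply/finite_image/finite_preimage => [s t _ _|]; [exact: finj | exact: finite_seq].
Qed.

(** [phi] is the inverse of the coordinate map [m]. The entries are polynomials [F] in [m], and [m]
    is given by polynomials [H] in the entries, so scaling by [c] reads [F (c * H)], a polynomial in
    [c] and the entries. *)
Lemma irr_unip_vspace : exists (E : vectType K) (phi : E -> 'M[K]_n),
  vspace_structure V phi /\ vspace_invariant G phi.
Proof.
have [||||||d [m [[mD minj msurj mst] [mR xF]]]] := @simple_module_linear K p T Kp Tp _ x
  _ _ x_deg x_closed Gt opG oneG act _ _ _ _ conn irr Tinf.
- move=> s t st; apply: X_inj; apply: (can_inj mxvecK); exact: trmx_inj.
- move=> v; have [M ME] := x_lin_mulr (X v); exists M => t; by rewrite -ME.
- move=> g s t; apply: X_inj; rewrite XD !actE !mulmxE; apply: conjmxM; exact: Gu (svalP g).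
- move=> g h t; apply: X_inj; rewrite !actE /= -mulmxE invmxM ?mulmxA //; apply: Gu; exact: svalP.
- by move=> t; apply: X_inj; rewrite actE /= invmx1 mulmx1 mul1mx.
- move=> g; have [M ME] := x_lin_mull (sval g); have [M' M'E] := x_lin_mulr (invmx (sval g)).
  by exists (M' *m M) => t; rewrite /x actE M'E ME mulmxA.
pose psi c := sval (cid (msurj c)).
have psiK c : m (psi c) = c := svalP (cid (msurj c)).
have Kpsi t : psi (m t) = t by apply: minj; rewrite psiK.
exists 'cV[K]_d, (fun c => X (psi c)); split; last first.
  move=> g Gg; have [rho rhoE] := mst (exist _ g Gg).
  exists (linfun (mulmx rho)) => c; rewrite lfunE /=.
  by rewrite -[X in mulmx rho X](psiK c) -rhoE Kpsi.
split.
- by move=> c d' /X_inj h; rewrite -(psiK c) h psiK.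
- apply/seteqP; split=> v /=; first by move=> [c _ <-].
  by move=> /X_surj[t <-]; exists (m t) => //; rewrite Kpsi.
- by move=> c d'; rewrite -XD; congr X; apply: minj; rewrite mD !psiK.
have mF j : exists F, alg (range (@coord K 'I_(n * n))) F /\
    forall t, m t j 0 = F (fun i => x t i 0).
  by have [F AF FE] := alg_factor (mR j); exists F; split=> // t; have := congr1 (fun f => f t) FE.
have PP i j : exists P : {mpoly K[1 + n * n]}, forall (c : K) (v : 'cV[K]_d),
    X (psi (c *: v)) i j = P.@[fun k => row_mx (c%:M : 'M[K]_1) (mxvec (X (psi v))) 0 k].
  have [F [AF FE]] := xF (mxvec_index i j).
  pose H k := sval (cid (mF k)).
  have [AH HE] : (forall k, alg (range (@coord K 'I_(n * n))) (H k)) /\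
      forall k t, m t k 0 = H k (fun i => x t i 0).
    by split=> k; have [] := svalP (cid (mF k)).
  have [|P PE] := @alg_meval K (1 + n * n)
      (fun z => F (fun k => z (lshift (n * n) ord0) * H k (fun l => z (rshift 1 l)))).
    apply: (@alg_subst _ _ _ (fun k (z : 'I_(1 + n * n) -> K) =>
      z (lshift (n * n) ord0) * H k (fun l => z (rshift 1 l)))) AF => k.
    apply: AlgMul; first by apply: AlgGen; exists (lshift (n * n) ord0).
    apply: (@alg_subst _ _ _ (fun l (z : 'I_(1 + n * n) -> K) => z (rshift 1 l))) (AH k) => l.
    by apply: AlgGen; exists (rshift 1 l).
  exists P => c v; rewrite -PE -mxvecE -/(entry _ _) -xE FE; congr F; apply/funext=> k.
  rewrite psiK mxE row_mxEl mxE eqxx mulr1n; congr (_ * _).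
  rewrite -[in LHS](psiK v) HE; congr (H k _); apply/funext=> l.
  by rewrite row_mxEr xE.
exists (fun i j => sval (cid (PP i j))) => c v i j.
exact: (svalP (cid (PP i j))).
Qed.

End Infinite.
End IrreducibleUnipotent.

(** Nontrivial finite [V] is set apart: Z/p with trivial action is irreducible, but a nonzero vector
    space over the infinite field [K] is never finite. *)
Theorem corollary1p1 (K : closedFieldType) (p : nat) (Kp : p \in [pchar K])
    (n : nat) (H V G : set 'M[K]_n)
    (H_alg : closed_subgroup H)
    (G_alg : closed_subgroup G) (G_conn : GL_connected G)
    (V_unip : unipotent p V)
    (H_sd : semidirect H V G)
    (V_irr : forall W : set 'M[K]_n, closed_subgroup W -> W `<=` V ->
       conj_invariant G W -> W = [set 1] \/ W = V) :
  [/\ forall u v, V u -> V v -> u * v = v * u,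
      forall v, V v -> v ^+ p = 1 &
      (finite_set V -> V = [set 1]) ->
      exists (E : vectType K) (phi : E -> 'M[K]_n),
        vspace_structure V phi /\ vspace_invariant G phi].
Proof.
have GV : conj_invariant G V.
  by move=> g v /(sd_subr H_sd) Hg Vv; exact: (sd_normal H_sd).
split.
- by move=> u v; exact: (irr_unip_abelian Kp V_unip G_alg GV V_irr).
- by move=> v; exact: (irr_unip_exponent Kp V_unip G_alg GV V_irr).
have [V1 _|Vn1 fin] := pselect (V = [set 1]); last first.
  by apply: (irr_unip_vspace Kp V_unip G_alg GV V_irr G_conn) => /fin.
have cE (c : 'rV[K]_0) : c = 0 by apply/rowP; case.
exists 'rV[K]_0, (fun=> 1); split; last first.
  move=> g Gg; exists 0 => c.
  by rewrite mulr1 -mulmxE mulmxV // (closed_subgroup_unit G_alg).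
split.
- by move=> c d _; rewrite (cE c) (cE d).
- by rewrite V1; apply/seteqP; split=> v /= => [[c _ <-] | ->] //; exists 0.
- by move=> c d; rewrite mulr1.
- exists (fun i j => ((1 : 'M[K]_n) i j)%:MP) => c z i j.
  by rewrite mevalC.
Qed.
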